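(* Let $\mathscr H$ be a separable infinite-dimensional complex Hilbert space. If $0<p<1$, then the Schatten class $S^p$ of operators on $\mathscr H$ is not a $\mathcal K$-space.
   Context: For $0<p<\infty$, $S^p$ is the quasi Banach space of compact operators $f$ on $\mathscr H$ whose singular numbers $(s_n(f))$ lie in $\ell^p$, with quasinorm $\|f\|_p=(\sum_n s_n(f)^p)^{1/p}$. A complex quasi Banach space $X$ is a $\mathcal K$-space if every short exact sequence $0\to\mathbb C\to Z\to X\to 0$ of quasi Banach spaces and (continuous linear) operators splits. Equivalently: for every dense subspace $X_0$ of $X$ and every quasilinear map $\varphi:X_0\to\mathbb C$ (i.e. homogeneous with $|\varphi(x+y)-\varphi(x)-\varphi(y)|\leq Q(\|x\|+\|y\|)$ for some $Q$ and all $x,y\in X_0$) there are a linear map $\ell:X_0\to\mathbb C$ and a constant $M$ with $|\varphi(x)-\ell(x)|\leq M\|x\|$ for all $x\in X_0$. *)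

(* Defs.v *)
From HB Require Import structures.
From mathcomp Require Import all_boot all_order all_algebra.
From mathcomp Require Import complex.
From mathcomp Require Import all_classical all_reals all_analysis.

Set Implicit Arguments.
Unset Strict Implicit.
Unset Printing Implicit Defensive.

Import Order.TTheory GRing.Theory Num.Theory.
Import numFieldNormedType.Exports.

Local Open Scope classical_set_scope.
Local Open Scope ring_scope.
Local Open Scope complex_scope.

Section QuasiBanach.
Variable R : realType.

(* A quasinormed space is carried by a linear subspace D of an ambient complex
   vector space V, with a quasinorm N whose values outside D are irrelevant.
   Spaces that are not presented inside a larger one take D = setT. *)
Record is_quasinormed (V : lmodType R[i]) (D : set V) (N : V -> R) : Prop := {
  quasinormed0 : D 0 ;
  quasinormedP : forall (a : R[i]) x y, D x -> D y -> D (a *: x + y) ;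
  quasinorm_ge0 : forall x, D x -> 0 <= N x ;
  quasinorm_eq0 : forall x, D x -> N x = 0 -> x = 0 ;
  quasinormZ : forall (a : R[i]) x, D x -> N (a *: x) = Normc.normc a * N x ;
  quasinormD : exists K : R,
    forall x y, D x -> D y -> N (x + y) <= K * (N x + N y) }.

Definition quasinorm_complete (V : lmodType R[i]) (D : set V) (N : V -> R) :=
  forall u : nat -> V, (forall n, D (u n)) ->
    (forall e, 0 < e ->
       exists n0, forall m n, (n0 <= m)%N -> (n0 <= n)%N -> N (u m - u n) < e) ->
    exists2 x, D x & N (u n - x) @[n --> \oo] --> (0 : R).

Definition is_quasi_banach (V : lmodType R[i]) (D : set V) (N : V -> R) :=
  is_quasinormed D N /\ quasinorm_complete D N.

Definition quasinorm_continuous (V W : zmodType)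
    (NV : V -> R) (NW : W -> R) (f : V -> W) :=
  forall x e, 0 < e ->
    exists2 d, 0 < d & forall y, NV (y - x) < d -> NW (f y - f x) < e.

(* Every short exact sequence 0 -> C -j-> Z -q-> (D, N) -> 0 of quasi Banach
   spaces and operators splits, that is, j has an operator as left inverse. *)
Definition K_space (V : lmodType R[i]) (D : set V) (N : V -> R) :=
  forall (Z : lmodType R[i]) (NZ : Z -> R)
         (j : {linear R[i]^o -> Z}) (q : {linear Z -> V}),
    is_quasi_banach setT NZ ->
    quasinorm_continuous (@Normc.normc R) NZ j ->
    quasinorm_continuous NZ N q ->
    injective j ->
    range j = [set z | q z = 0] ->
    range q = D ->
    exists2 P : {linear Z -> R[i]^o},
      quasinorm_continuous NZ (@Normc.normc R) P & cancel j P.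

End QuasiBanach.

Section Dimension.
Variables (K : fieldType) (V : lmodType K).

Definition has_dim (E : set V) (d : nat) :=
  exists2 e : 'I_d -> V,
    (forall a : 'I_d -> K, \sum_i a i *: e i = 0 -> forall i, a i = 0) &
    E = [set \sum_i a i *: e i | a in [set: 'I_d -> K]].

Definition infinite_dimensional := forall d, ~ has_dim [set: V] d.

End Dimension.

Definition separable (T : topologicalType) :=
  exists2 A : set T, countable A & dense A.

Definition compact_operator (R : realType) (H : normedModType R[i])
    (f : H -> H) :=
  linear f /\ precompact (f @` [set x | `|x| <= 1]).

Section Schatten.
Variables (R : realType) (H : completeNormedModType R[i]).
Variable dot : {dot H for (@Num.conj R[i])}.

Definition adjoint (f : H -> H) : H -> H :=
  xget (cst 0) [set g | forall x y, dot (f x) y = dot x (g y)].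

(* s lists the square roots of the nonzero eigenvalues of (adjoint f \o f) in
   nonincreasing order, each lambda > 0 as many times as the dimension of the
   eigenspace of lambda ^+ 2. When there are only finitely many of them, the
   sequence is completed by zeros, no other value being allowed. *)
Definition is_singular_numbers (f : H -> H) (s : nat -> R) :=
  [/\ forall n, 0 <= s n,
      forall m n, (m <= n)%N -> s n <= s m &
      forall lambda : R, 0 < lambda ->
        exists2 d,
          has_dim [set x | adjoint f (f x) = (lambda ^+ 2)%:C *: x] d &
          ([set n | s n = lambda] #= `I_d)%card].

(* For compact f there is exactly one such sequence. *)
Definition singular_numbers (f : H -> H) : nat -> R :=
  xget (cst 0) (is_singular_numbers f).

Definition schatten (p : R) : set (H -> H) :=
  [set f | compact_operator f /\
           cvgn (series (fun n => singular_numbers f n `^ p))].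

Definition schatten_norm (p : R) (f : H -> H) : R :=
  limn (series (fun n => singular_numbers f n `^ p)) `^ p^-1.

End Schatten.

(* Main.v *)
(* A compact operator has a Schmidt decomposition: its norm is attained at some
   unit vector x (a maximizing sequence is Cauchy by the parallelogram law), and
   one continues on the orthogonal complement of x.  This identifies the
   singular numbers, and the Courant-Fischer inequality gives
   s_(m+n)(f + g) <= s_m(f) + s_n(g), whence the quasi Banach space structure.

   For an orthonormal sequence e, the diagonal f |-> (<f e_k, e_k>)_k maps S^p,
   p < 1, into l^1, since sum_n s_n(f) <= |f|_p.  On finite sequences Ribe's map
   a |-> sum_k a_k ln|a_k| - (sum_k a_k) ln|sum_k a_k| is quasilinear for the
   l^1 norm, with a constant independent of the length.  A linear functional on
   all complex sequences that extends an ultrafilter limit turns the Ribe maps of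
   the truncated diagonals into one quasilinear map phi on S^p, and the twisted
   sum of C and S^p along phi does not split: if l is linear and
   |phi - l| <= M |.|_p, then for suitable signs the vector
   u = sum_(k < n) +- e_k satisfies
   Re l(u (x) u) >= sum_(k < n) Re l(e_k (x) e_k) >= - M n, while
   phi(u (x) u) = - n ln n and |u (x) u|_p = n. *)
Require Import Defs.
From HB Require Import structures.
From mathcomp Require Import all_boot all_order all_algebra.
From mathcomp Require Import complex.
From mathcomp Require Import all_classical all_reals all_analysis.
From mathcomp Require Import finmap ring lra.

Set Implicit Arguments.
Unset Strict Implicit.
Unset Printing Implicit Defensive.

Import Order.TTheory GRing.Theory Num.Theory.
Import numFieldNormedType.Exports.

Local Open Scope classical_set_scope.
Local Open Scope ring_scope.
Local Open Scope complex_scope.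
Local Notation normc := (@Normc.normc _).
Local Notation Re := (@complex.Re _).
Local Notation Im := (@complex.Im _).

(** For a in l^1 the sum of a_k ln|a_k| may diverge, already for the diagonal of some u (x) u. The
    Ribe values of the truncated diagonals of one operator can therefore be unbounded in the length;
    only their defects from additivity are bounded, uniformly in the length. Hence the generalized
    limit has to be linear on all sequences, while a bound for it is available, and used, only on
    bounded ones: homogeneity of phi comes from the linearity, quasilinearity from the bound applied
    to the defects. As phi lives on the whole of S^p, the twisted sum is complete as it stands.

    Adjoint and singular numbers are defined by choice with a default value, so nothing can be read
    off before existence (and, for the numbers, uniqueness) is known. Both are derived from the
    Schmidt decomposition, which is for this reason built without adjoints.

    Suitable signs exist because the average of u (x) u over all signs is the sum of the e_k (x)
    e_k; the parallelogram law performs this averaging one vector at a time. *)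

(** * Inner product identities in real-valued form *)

Section Hilbert.
Variables (R : realType) (H : completeNormedModType R[i]).
Variable dot : {dot H for (@Num.conj R[i])}.
Hypothesis hdot : forall x : H, `|x| ^+ 2 = dot x x.

Implicit Types (x y u v w : H) (a b : R[i]).

(** The norm of [H] takes its values in [R[i]]; its real part lets the estimates be carried out in
    the ordered field [R]. *)
Definition nr x : R := Re `|x|.

Lemma nrC x : `|x| = (nr x)%:C.
Proof. by rewrite RRe_real // ger0_real. Qed.

Lemma nr_ge0 x : 0 <= nr x.
Proof. by rewrite -ler0c -nrC. Qed.

Lemma nrZ a x : nr (a *: x) = normc a * nr x.
Proof. by apply: complexI; rewrite -nrC normrZ nrC rmorphM. Qed.

Lemma nrD x y : nr (x + y) <= nr x + nr y.
Proof. by rewrite -lecR rmorphD /= -!nrC ler_normD. Qed.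

Lemma nrN x : nr (- x) = nr x.
Proof. by rewrite /nr normrN. Qed.

Lemma nr0 : nr 0 = 0.
Proof. by rewrite /nr normr0. Qed.

Lemma nr_eq0 x : nr x = 0 -> x = 0.
Proof. by move=> h; apply/eqP; rewrite -normr_eq0 nrC h. Qed.

Lemma nr_gt0 x : x != 0 -> 0 < nr x.
Proof.
move=> x0; rewrite lt_neqAle nr_ge0 andbT eq_sym.
by apply: contraNN x0 => /eqP/nr_eq0->.
Qed.

Lemma nrB x y : nr (x - y) = nr (y - x).
Proof. by rewrite -nrN opprB. Qed.

Lemma dotxx x : dot x x = (nr x ^+ 2)%:C.
Proof. by rewrite -hdot nrC rmorphXn. Qed.

Lemma dotC x y : dot y x = conjc (dot x y).
Proof. by rewrite hermC /= expr0 mul1r. Qed.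

Lemma dotDl x y z : dot (x + y) z = dot x z + dot y z.
Proof. exact: linearDl. Qed.
Lemma dotBl x y z : dot (x - y) z = dot x z - dot y z.
Proof. exact: linearBl. Qed.
Lemma dotZl a x z : dot (a *: x) z = a * dot x z.
Proof. exact: linearZl_LR. Qed.
Lemma dot0l z : dot 0 z = 0.
Proof. exact: linear0l. Qed.
Lemma dotNl x z : dot (- x) z = - dot x z.
Proof. exact: linearNl. Qed.
Lemma dot_suml I (r : seq I) (P : pred I) (F : I -> H) z :
  dot (\sum_(i <- r | P i) F i) z = \sum_(i <- r | P i) dot (F i) z.
Proof. by rewrite linear_sumlz. Qed.
Lemma dotDr x y z : dot z (x + y) = dot z x + dot z y.
Proof. by rewrite (dotC (x + y)) dotDl rmorphD (dotC x) (dotC y). Qed.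
Lemma dotBr x y z : dot z (x - y) = dot z x - dot z y.
Proof. by rewrite (dotC (x - y)) dotBl rmorphB (dotC x) (dotC y). Qed.
Lemma dotZr a x z : dot z (a *: x) = conjc a * dot z x.
Proof. by rewrite (dotC (a *: x)) dotZl rmorphM (dotC x). Qed.
Lemma dot0r z : dot z 0 = 0.
Proof. by rewrite dotC dot0l rmorph0. Qed.
Lemma dotNr x z : dot z (- x) = - dot z x.
Proof. by rewrite (dotC (- x)) dotNl rmorphN (dotC x). Qed.
Lemma dot_sumr I (r : seq I) (P : pred I) (F : I -> H) z :
  dot z (\sum_(i <- r | P i) F i) = \sum_(i <- r | P i) dot z (F i).
Proof.
by rewrite dotC dot_suml rmorph_sum; apply: eq_bigr => i _; rewrite (dotC (F i)).
Qed.

Lemma dot_eq0_sym x y : dot x y = 0 -> dot y x = 0.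
Proof. by rewrite (dotC x y) => ->; rewrite rmorph0. Qed.

Lemma normcE (a : R[i]) : normc a ^+ 2 = Re a ^+ 2 + Im a ^+ 2.
Proof. by case: a => p q /=; rewrite sqr_sqrtr // addr_ge0 // sqr_ge0. Qed.

Lemma mulcJ (a : R[i]) : conjc a * a = (normc a ^+ 2)%:C.
Proof.
rewrite normcE; case: a => p q; simpc; congr (_ +i* _); ring.
Qed.

Lemma normc_ge0 (a : R[i]) : 0 <= normc a.
Proof. by case: a => p q /=; rewrite sqrtr_ge0. Qed.

Lemma normc_gt0 (a : R[i]) : a != 0 -> 0 < normc a.
Proof.
move=> a0; rewrite lt_neqAle normc_ge0 andbT eq_sym.
by apply: contraNN a0 => /eqP/Normc.eq0_normc->.
Qed.

Lemma normc_conj (a : R[i]) : normc (conjc a) = normc a.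
Proof. by case: a => p q /=; rewrite sqrrN. Qed.

Lemma normc_real (t : R) : normc (t%:C) = `|t|.
Proof. by rewrite /= expr0n addr0 sqrtr_sqr. Qed.

Lemma normc_Re (a : R[i]) : `|Re a| <= normc a.
Proof. by rewrite -lecR; exact: normc_ge_Re. Qed.

Lemma normc_Im (a : R[i]) : `|Im a| <= normc a.
Proof.
by case: a => p q /=; rewrite -sqrtr_sqr ler_sqrt ?lerDr ?sqr_ge0 // addr_ge0 ?sqr_ge0.
Qed.

Lemma normc_le_ReIm (a : R[i]) : normc a <= `|Re a| + `|Im a|.
Proof.
have abs0 (t : R) : 0 <= `|t| by exact: normr_ge0.
rewrite -(@ler_pXn2r _ 2) ?nnegrE ?normc_ge0 ?addr_ge0 // normcE.
rewrite sqrrD !real_normK ?num_real // lerD2r lerDl mulrn_wge0 // mulr_ge0.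
Qed.

Lemma ReD a b : Re (a + b) = Re a + Re b.
Proof. by case: a; case: b. Qed.

Lemma ReM_real (t : R) a : Re (t%:C * a) = t * Re a.
Proof. by case: a => p q /=; rewrite mul0r subr0. Qed.

Lemma nrD2 x y : nr (x + y) ^+ 2 = nr x ^+ 2 + nr y ^+ 2 + 2 * Re (dot x y).
Proof.
apply: complexI; rewrite -dotxx dotDl !dotDr (dotC x y) !dotxx.
case: (dot x y) => p q; rewrite /=; simpc; congr (_ +i* _); ring.
Qed.

Lemma nrB2 x y : nr (x - y) ^+ 2 = nr x ^+ 2 + nr y ^+ 2 - 2 * Re (dot x y).
Proof. by rewrite nrD2 nrN dotNr raddfN /= mulrN. Qed.

Lemma parallelogram x y :
  nr (x + y) ^+ 2 + nr (x - y) ^+ 2 = 2 * nr x ^+ 2 + 2 * nr y ^+ 2.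
Proof. by rewrite nrD2 nrB2; ring. Qed.

Lemma pythagoras x y : dot x y = 0 -> nr (x + y) ^+ 2 = nr x ^+ 2 + nr y ^+ 2.
Proof. by move=> h; rewrite nrD2 h mulr0 addr0. Qed.

(** The square norm of |y|^2 x - <x, y> y equals |y|^2 (|x|^2 |y|^2 - |<x, y>|^2), and for nonzero y
    the first factor is positive. *)
Lemma CauchySchwarz x y : normc (dot x y) <= nr x * nr y.
Proof.
have [->|y0] := eqVneq y 0; first by rewrite dot0r nr0 mulr0 Normc.normc0.
have n0 := nr_gt0 y0.
rewrite -(@ler_pXn2r _ 2) ?nnegrE ?mulr_ge0 ?nr_ge0 ?normc_ge0 // exprMn.
have := sqr_ge0 (nr ((nr y ^+ 2)%:C *: x - dot x y *: y)).
rewrite nrB2 !nrZ dotZl dotZr mulcJ normc_real.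
rewrite -rmorphM /= !exprMn real_normK ?num_real //.
move: (sqr_ge0 (nr y)) (exprn_gt0 2 n0) => /=.
move: (nr y ^+ 2) (normc _ ^+ 2) (nr x ^+ 2) => n c m _ npos.
(match goal with |- is_true (0 <= ?e) -> _ =>
  have -> : e = n * (m * n - c) by ring end).
by rewrite pmulr_rge0 // subr_ge0.
Qed.

(* |F(u + t x)|^2 <= s^2 |u + t x|^2 for every scalar t, and the terms of
   second order in t cancel, so the terms of first order vanish. *)
Lemma norm_attained_orthogonal (F : H -> H) (s : R) x : linear F ->
  (forall u, nr (F u) <= s * nr u) -> nr (F x) = s * nr x ->
  forall u, dot (F x) (F u) = (s ^+ 2)%:C * dot x u.
Proof.
move=> linF Fle Fx u; apply/eqP; rewrite -subr_eq0; apply/eqP/Normc.eq0_normc/eqP.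
set b := _ - _; rewrite -sqrf_eq0; apply: contraT => c0.
have cpos : 0 < normc b ^+ 2 by rewrite lt_neqAle eq_sym c0 sqr_ge0.
pose q := s ^+ 2 * nr u ^+ 2 - nr (F u) ^+ 2.
have key (k : R) : 2 * (k * normc b ^+ 2) <= q.
  have := Fle ((k%:C * conjc b) *: x + u).
  rewrite -(@ler_pXn2r _ 2) ?nnegrE ?nr_ge0 //; last first.
    by rewrite (le_trans _ (Fle _)) ?nr_ge0.
  rewrite linF exprMn !nrD2 !nrZ !dotZl Fx.
  have -> : dot (F x) (F u) = b + (s ^+ 2)%:C * dot x u by rewrite subrK.
  have -> : k%:C * conjc b * (b + (s ^+ 2)%:C * dot x u) =
      k%:C * (conjc b * b) + (s ^+ 2)%:C * (k%:C * conjc b * dot x u) by ring.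
  rewrite mulcJ ReD !ReM_real !exprMn.
  rewrite /q /=; set z := complex.Re _; set w := normc (_ * _) ^+ 2.
  rewrite -subr_ge0 => h; rewrite -subr_ge0; move: h; congr (_ <= _); ring.
have := key ((q + 1) / (2 * normc b ^+ 2)).
have -> : 2 * ((q + 1) / (2 * normc b ^+ 2) * normc b ^+ 2) = q + 1.
  by field; rewrite -sqrf_eq0.
by rewrite gerDl ler10.
Qed.
End Hilbert.

(** * Linear algebra in finite dimension *)

Lemma exists_kernel (K : fieldType) (m n : nat) (M : 'I_m -> 'I_n -> K) :
  (n < m)%N ->
  exists2 a : 'I_m -> K, (exists i, a i != 0) &
    forall j, \sum_i a i * M i j = 0.
Proof.
move=> nm; pose A : 'M[K]_(m, n) := \matrix_(i, j) M i j.
have : kermx A != 0.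
  by rewrite kermx_eq0 -row_leq_rank -ltnNge (leq_ltn_trans (rank_leq_col A)).
case/rowV0Pn => v /sub_kermxP vA v0; exists (fun i => v 0 i).
  by apply/existsP; rewrite -negb_forall; apply: contraNN v0 => /forallP h;
    apply/eqP/rowP => i; rewrite mxE; apply/eqP; move: (h i); rewrite ?negbK.
move=> j; have /matrixP/(_ 0 j) := vA; rewrite !mxE => vAj; rewrite -[RHS]vAj.
by apply: eq_bigr => i _; rewrite mxE.
Qed.

(** If n < m, the matrix that expresses m independent vectors through n generators has a nonzero
    left kernel vector, which is a linear relation. This makes the multiplicities in
    [is_singular_numbers] well defined. *)
Lemma dim_unique (K : fieldType) (V : lmodType K) (E : set V) d d' :
  has_dim E d -> has_dim E d' -> d = d'.
Proof.
suff le_dim (m n : nat) : has_dim E m -> has_dim E n -> (m <= n)%N.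
  by move=> h h'; apply/eqP; rewrite eqn_leq !le_dim.
move=> [e ef Ee] [g _ Eg]; rewrite leqNgt; apply/negP => nm.
have eE i : E (e i).
  rewrite Ee; exists (fun j => (j == i)%:R) => //.
  rewrite (bigD1 i) //= eqxx scale1r big1 ?addr0 // => j /negPf ->.
  by rewrite scale0r.
have /choice[M hM] : forall i, exists c : 'I_n -> K, \sum_j c j *: g j = e i.
  by move=> i; have := eE i; rewrite Eg => -[c _ <-]; exists c.
have [a [i ai]] := exists_kernel M nm; move=> aM; move/eqP: ai; apply.
apply: (ef a); rewrite (eq_bigr (fun i => \sum_j (a i * M i j) *: g j)).
  by rewrite exchange_big big1 //= => j _; rewrite -scaler_suml aM scale0r.
by move=> k _; rewrite -hM scaler_sumr; apply: eq_bigr => j _; rewrite scalerA.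
Qed.

(** * Completeness and compactness in terms of sequences *)

Section Sequences.
Variables (R : realType) (H : completeNormedModType R[i]).
Implicit Types (x y u v w : H).

Lemma nr_ball x (e : R) y : 0 < e -> ball x (e%:C) y <-> nr (y - x) < e.
Proof.
by move=> e0; rewrite -ball_normE /ball_ /= nrC ltcR nrB.
Qed.

Lemma complete_seq (u : nat -> H) :
  (forall e : R, 0 < e -> exists n0, forall m n, (n0 <= m)%N -> (n0 <= n)%N ->
     nr (u m - u n) < e) ->
  exists l, forall e : R, 0 < e -> exists n0, forall n, (n0 <= n)%N ->
    nr (u n - l) < e.
Proof.
move=> cu; have cvu : cvg (u @ \oo).
  apply/cauchy_cvgP/cauchyP => -[e0 i0]; rewrite ltcE /= => /andP[/eqP i0E e0p].
  have [n0 hn0] := cu _ e0p; exists (u n0); near=> n.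
  have -> : e0 +i* i0 = e0%:C by rewrite i0E.
  by apply/nr_ball => //; apply: hn0 => //; near: n; exact: nbhs_infty_ge.
exists (lim (u @ \oo)) => e e0; have : \forall n \near \oo, ball (lim (u @ \oo)) e%:C (u n).
  by apply: (cvu (ball _ e%:C)); apply: nbhsx_ballx; rewrite ltcR.
by case=> n0 _ hn0; exists n0 => n /hn0 /nr_ball; apply.
Unshelve. all: by end_near. Qed.

(** The sequential consequence of compactness that suffices for the Schmidt decomposition and passes
    directly to the deflated operators. *)
Definition cluster_compact (f : H -> H) :=
  linear f /\ forall u : nat -> H, (forall n, nr (u n) <= 1) ->
    exists y, forall (e : R) N, 0 < e ->
      exists2 n, (N <= n)%N & nr (f (u n) - y) < e.

Lemma compact_cluster (f : H -> H) : compact_operator f -> cluster_compact f.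
Proof.
case=> linf; rewrite precompactE => cf; split => // u u1.
have [y [_ yu]] : closure (f @` [set x | `|x| <= 1]) `&` cluster ((f \o u) @ \oo) !=set0.
  apply: cf; exists 0%N => // n _ /=; apply: subset_closure; exists (u n) => //=.
  by rewrite nrC lecR.
exists y => e N e0.
have ye : nbhs y (ball y e%:C) by apply: nbhsx_ballx; rewrite ltcR.
have FN : ((f \o u) @ \oo) [set (f \o u) n | n in [set n | (N <= n)%N]].
  by exists N => // n Nn; exists n.
have [_ [[n Nn <-] yn]] := yu _ _ FN ye.
by exists n => //; apply/nr_ball.
Qed.

End Sequences.

Lemma linear_bundle (K : nzRingType) (V W : lmodType K) (f : V -> W) :
  linear f -> exists g : {linear V -> W}, f = g.
Proof.
move=> lf; pose m := GRing.isLinear.Build K V W *:%R f lf.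
by exists (HB.pack f m : {linear V -> W}).
Qed.

Lemma natSinv_lt (R : realType) (e : R) : 0 < e ->
  exists N, forall n, (N <= n)%N -> n.+1%:R^-1 < e.
Proof.
move=> e0; exists (Num.trunc e^-1) => n Nn.
rewrite invf_plt ?posrE // (lt_le_trans (truncnS_gt _)) // ler_nat ltnS.
exact: Nn.
Qed.

(** The Cauchy estimate for a maximizing sequence v: [a] is |v_m + v_n|, [f] is |v_m - v_n|^2, [b]
    and [c] are |v_n|^2 and |v_m|^2, and [E] is the square of the tolerance. *)
Lemma parallelogram_gap (R : realType) (a b c f E : R) :
  0 <= a -> 0 < E -> b <= 1 -> c <= 1 -> a ^+ 2 + f = 2 * c + 2 * b ->
  2 - 4 * (E / 32) <= a -> f < E.
Proof.
move=> a0 E0 b1 c1 abcf aE; suff : 4 - E < a ^+ 2 by lra.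
have [E4|E4] := lerP E 4; last by have := sqr_ge0 a; lra.
have e0 : 0 <= 2 - E / 8 by lra.
have aE' : 2 - E / 8 <= a by lra.
by have := ler_pM e0 e0 aE' aE'; rewrite -!expr2; nra.
Qed.

(** * A compact operator attains its norm *)

Section Maximum.
Variables (R : realType) (H : completeNormedModType R[i]).
Variable dot : {dot H for (@Num.conj R[i])}.
Hypothesis hdot : forall x : H, `|x| ^+ 2 = dot x x.
Implicit Types (x y u v w : H).

Lemma linear_bound_ball (f : {linear H -> H}) (S : R) :
  (forall u, nr u <= 1 -> nr (f u) <= S) -> forall u, nr (f u) <= S * nr u.
Proof.
move=> hS u; have [->|u0] := eqVneq u 0; first by rewrite linear0 !nr0 mulr0.
have n0 := nr_gt0 u0.
rewrite -ler_pdivrMr // mulrC.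
have := hS ((nr u)^-1%:C *: u); rewrite linearZ /= !nrZ normc_real ger0_norm ?invr_ge0 ?nr_ge0 //.
by apply; rewrite mulVf // gt_eqF.
Qed.

Lemma norm_attained (f : H -> H) : cluster_compact f ->
  exists x, (forall u, nr (f u) <= nr (f x) * nr u) /\ (nr x = 1 \/ x = 0).
Proof.
case=> /linear_bundle[g ->] {f} cg.
have [M hM] : exists M, forall u, nr u <= 1 -> nr (g u) <= M.
  apply: contrapT => nb.
  have /choice[u hu] : forall n : nat, exists u, nr u <= 1 /\ n%:R < nr (g u).
    move=> n; apply: contrapT => nu; apply: nb; exists n%:R => u u1.
    by rewrite leNgt; apply/negP => h; apply: nu; exists u.
  have [y hy] := cg u (fun n => (hu n).1).
  have [n Nn] := hy 1 (Num.trunc (nr y + 1)).+1 ltr01.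
  have := (hu n).2; have := nrD (g (u n) - y) y; rewrite subrK => h1 h2 h3.
  have : nr y + 1 < n%:R by rewrite (lt_le_trans (truncnS_gt _)) // ler_nat.
  lra.
pose A := [set nr (g u) | u in [set u | nr u <= 1]].
have supA : has_sup A.
  split; first by exists (nr (g 0)), 0 => //=; rewrite nr0 ler01.
  by exists M => _ [u u1 <-]; exact: hM.
set S := sup A; have S0 : 0 <= S.
  apply: (le_trans (nr_ge0 (g 0))); apply: sup_upper_bound => //.
  by exists 0 => //=; rewrite nr0 ler01.
have gS u : nr (g u) <= S * nr u.
  by apply: linear_bound_ball => v v1; apply: sup_upper_bound => //; exists v.
have [S00|Sn0] := eqVneq S 0.
  exists 0; split; last by right.
  by move=> u; rewrite linear0 nr0 mul0r -(mul0r (nr u)) -S00.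
have Sp : 0 < S by rewrite lt_neqAle eq_sym Sn0.
have /choice[u hu] : forall n : nat, exists u, nr u <= 1 /\ S - n.+1%:R^-1 < nr (g u).
  move=> n; have [|_ [u u1 <-] h] := sup_adherent (eps := n.+1%:R^-1) _ supA.
    by rewrite invr_gt0 ltr0n.
  by exists u.
have [y hy] := cg u (fun n => (hu n).1).
(* Passing to terms whose images also approach [y]: [v] is still maximizing, and now its images
   converge. *)
have /choice[v hv] : forall n : nat, exists v,
    [/\ nr v <= 1, S - n.+1%:R^-1 < nr (g v) & nr (g v - y) < n.+1%:R^-1].
  move=> n; have [|m nm hm] := hy n.+1%:R^-1 n; first by rewrite invr_gt0 ltr0n.
  exists (u m); split => //; first exact: (hu m).1.
  apply: le_lt_trans (hu m).2; rewrite lerD2l lerN2 lef_pV2 ?posrE ?ltr0n //.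
  by rewrite ler_nat.
have hvd (d : R) : 0 < d -> exists N, forall n, (N <= n)%N ->
    [/\ nr (v n) <= 1, S - d < nr (g (v n)) & nr (g (v n) - y) < d].
  move=> /natSinv_lt[N hN]; exists N => n /hN h; have [h1 h2 h3] := hv n.
  by split => //; [move: h2|move: h3]; move: (n.+1%:R^-1) h => t *; lra.
have [|x hx] := @complete_seq _ _ v.
  (* With this [d], the quotient [d / S] is e^2 / 32, the form required by [parallelogram_gap]. *)
  move=> e e0; pose d := e ^+ 2 * S / 32.
  have dp : 0 < d by rewrite /d !mulr_gt0 ?exprn_gt0 ?invr_gt0.
  have [N hN] := hvd d dp; exists N => m n /hN[m1 mS my] /hN[n1 nS ny].
  (* The sum of the two images has norm at least 2 |g v_m| - |g v_m - g v_n|; the first term exceeds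
     2 (S - d), and the images are within 2 d of each other through [y]. *)
  have h1 : 2 * S - 4 * d <= S * nr (v m + v n).
    apply: le_trans (gS _); rewrite linearD /=.
    have := nrD (g (v m) + g (v n)) (g (v m) - g (v n)).
    rewrite addrACA subrr addr0 -mulr2n -scaler_nat nrZ.
    rewrite -(rmorph_nat (real_complex R)) normc_real normr_nat.
    have := nrD (g (v m) - y) (y - g (v n)); rewrite addrA subrK (nrB y).
    lra.
  have h2 : 2 - 4 * (d / S) <= nr (v m + v n).
    rewrite -(ler_pM2l Sp) (le_trans _ h1) // le_eqVlt; apply/orP; left.
    by apply/eqP; field.
  rewrite -(@ltr_pXn2r _ 2) ?nnegrE ?nr_ge0 ?ltW //.
  have dS : d / S = e ^+ 2 / 32 by rewrite /d; field.
  have := parallelogram hdot (v m) (v n).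
  have : nr (v m) ^+ 2 <= 1 by rewrite expr_le1 ?nr_ge0.
  have : nr (v n) ^+ 2 <= 1 by rewrite expr_le1 ?nr_ge0.
  rewrite dS in h2 => n2 m2 pl.
  by apply: parallelogram_gap n2 m2 pl h2; rewrite ?nr_ge0 ?sqr_ge0 ?exprn_gt0.
have x1 : nr x <= 1.
  apply/ler_addgt0Pr => e e0; have [N hN] := hx e e0.
  have := nrD (v N) (x - v N); rewrite addrC subrK nrB.
  by have := hN N (leqnn _); have [] := hv N; lra.
have gx : S <= nr (g x).
  apply/ler_addgt0Pr => e e0.
  have e1 : 0 < e / (1 + S) by rewrite divr_gt0 // addr_gt0.
  have [N1 hN1] := hx _ e1; have [N2 hN2] := hvd _ e1.
  pose n := maxn N1 N2.
  have := hN1 n (leq_maxl _ _); have [_ + _] := hN2 n (leq_maxr _ _).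
  have := nrD (g x) (g (v n) - g x); rewrite addrC subrK -linearB /=.
  have := gS (v n - x); set d := e / (1 + S) => k1 k2 k3 k4.
  have : S * nr (v n - x) <= S * d by rewrite ler_pM2l // ltW.
  have : d + S * d = e by rewrite /d; field; rewrite gt_eqF // addr_gt0.
  lra.
have gxS : nr (g x) = S.
  apply/eqP; rewrite eq_le gx andbT (le_trans (gS x)) // ler_piMr //.
exists x; rewrite gxS; split => //; left.
by apply/eqP; rewrite eq_le x1 -(ler_pM2l Sp) mulr1 (le_trans gx).
Qed.

End Maximum.

(** * The Schmidt decomposition *)

Section Schmidt.
Variables (R : realType) (H : completeNormedModType R[i]).
Variable dot : {dot H for (@Num.conj R[i])}.
Hypothesis hdot : forall x : H, `|x| ^+ 2 = dot x x.
Implicit Types (x : nat -> H) (u v w : H).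

(** Zero entries are allowed, so that operators of finite rank are also described by sequences
    indexed by all natural numbers. *)
Definition orthosystem x :=
  (forall m n, m != n -> dot (x m) (x n) = 0) /\
  (forall n, nr (x n) = 1 \/ x n = 0).

Definition orthoproj x n u := \sum_(k < n) dot u (x k) *: x k.

Lemma orthosystem_le1 x n : orthosystem x -> nr (x n) <= 1.
Proof. by case=> _ /(_ n)[->//|->]; rewrite nr0 ler01. Qed.

Lemma orthoproj_dot x n u j : orthosystem x -> (j < n)%N ->
  dot (orthoproj x n u) (x j) = dot u (x j).
Proof.
case=> xo x1 jn; rewrite dot_suml (bigD1 (Ordinal jn)) //= big1 ?addr0.
  rewrite dotZl (dotxx hdot) //; case: (x1 j) => [->|->]; first by rewrite expr1n mulr1.
  by rewrite dot0r mul0r.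
by move=> k kj; rewrite dotZl xo ?mulr0.
Qed.

Lemma orthoproj_resid x n u j : orthosystem x -> (j < n)%N ->
  dot (u - orthoproj x n u) (x j) = 0.
Proof. by move=> hx jn; rewrite dotBl orthoproj_dot // subrr. Qed.

Lemma orthoproj_perp x n u (a : nat -> R[i]) : orthosystem x ->
  dot (u - orthoproj x n u) (\sum_(k < n) a k *: x k) = 0.
Proof.
by move=> hx; rewrite dot_sumr big1 // => k _; rewrite dotZr orthoproj_resid ?mulr0.
Qed.

Lemma orthosum_norm x n (a : nat -> R[i]) : orthosystem x ->
  (forall k, (k < n)%N -> x k = 0 -> a k = 0) ->
  nr (\sum_(k < n) a k *: x k) ^+ 2 = \sum_(k < n) normc (a k) ^+ 2.
Proof.
move=> [xo x1]; elim: n => [|n IHn] ha; first by rewrite !big_ord0 nr0 expr0n.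
rewrite !big_ord_recr /= (pythagoras hdot) //; last first.
  by rewrite dot_suml big1 // => k _; rewrite dotZl dotZr xo ?mulr0 // ltn_eqF.
rewrite IHn; last by move=> k kn; apply: ha; rewrite ltnW.
congr (_ + _); rewrite nrZ; case: (x1 n) => [->|x0]; first by rewrite mulr1.
by rewrite (ha n) // normc_real normr0 mul0r.
Qed.

Lemma bessel x n u : orthosystem x ->
  \sum_(k < n) normc (dot u (x k)) ^+ 2 <= nr u ^+ 2.
Proof.
move=> hx; rewrite -(orthosum_norm (a := fun k => dot u (x k)) hx); last first.
  by move=> k _ ->; rewrite dot0r.
rewrite -/(orthoproj x n u) -{2}(subrK (orthoproj x n u) u) (pythagoras hdot) //.
  by rewrite lerDr sqr_ge0.
exact: (orthoproj_perp _ _ (fun k => dot u (x k))).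
Qed.

(** [schmidt_dot] is the eigenvalue equation of x_n for the product of the adjoint with f, written
    weakly because the adjoint is only constructed later from this record. [schmidt_tail] together
    with [schmidt_small] stands for the convergence of the expansion of f. *)
Record schmidt (f : H -> H) (s : nat -> R) (x : nat -> H) : Prop := {
  schmidt_linear : linear f ;
  schmidt_ortho : orthosystem x ;
  schmidt_norm : forall n, nr (f (x n)) = s n ;
  schmidt_null : forall n, s n = 0 -> x n = 0 ;
  schmidt_noninc : forall m n, (m <= n)%N -> s n <= s m ;
  schmidt_small : forall e : R, 0 < e -> exists n, s n < e ;
  schmidt_dot : forall n u, dot (f (x n)) (f u) = (s n ^+ 2)%:C * dot (x n) u ;
  schmidt_tail : forall n u, (forall m, (m < n)%N -> dot u (x m) = 0) ->
    nr (f u) <= s n * nr u }.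

(** The last clause forces the vector 0 once the operator vanishes, whence [schmidt_null]. *)
Definition maximizer (f : H -> H) : H :=
  xget 0 [set x | [/\ forall u, nr (f u) <= nr (f x) * nr u,
                      nr x = 1 \/ x = 0 & nr (f x) = 0 -> x = 0]].

Lemma maximizerP f : cluster_compact f ->
  [/\ forall u, nr (f u) <= nr (f (maximizer f)) * nr u,
      nr (maximizer f) = 1 \/ maximizer f = 0 &
      nr (f (maximizer f)) = 0 -> maximizer f = 0].
Proof.
move=> cf; rewrite /maximizer; case: xgetP => // nex.
have [x [xmax x1]] := norm_attained hdot cf.
case: (eqVneq (nr (f x)) 0) => [fx0|fx0].
  case: (nex 0); split; [|by right|by []].
  move=> u; rewrite (le_trans (xmax u)) // fx0 mul0r mulr_ge0 // ?nr_ge0 //.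
by case: (nex x); split => // /eqP; rewrite (negPf fx0).
Qed.

(** For linear f and y a unit vector or 0, this is f after the orthogonal projection off y. The
    iteration thus stays with operators on [H] instead of restricting f to smaller and smaller
    subspaces. *)
Definition deflate (f : H -> H) (y : H) u := f u - dot u y *: f y.

Lemma deflate_cluster f (x : H) : nr x = 1 \/ x = 0 ->
  cluster_compact f -> cluster_compact (deflate f x).
Proof.
move=> x1 [/linear_bundle[g ->] cg]; have dE u : deflate g x u = g (u - dot u x *: x).
  by rewrite linearB linearZ.
split.
  move=> a u v; rewrite !dE -linearP; congr (g _); rewrite dotDl dotZl.
  by rewrite scalerBr scalerDl scalerA addrACA -opprD.
move=> u u1; have [|y hy] := cg (fun n => u n - dot (u n) x *: x).
  move=> n; apply: le_trans (u1 n); rewrite -(@ler_pXn2r _ 2) ?nnegrE ?nr_ge0 //.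
  case: x1 => [x1|->]; last by rewrite dot0r scale0r subr0.
  rewrite (nrB2 hdot) nrZ x1 mulr1 dotZr mulcJ /= -addrA gerDl.
  by have := sqr_ge0 (normc (dot (u n) x)); lra.
by exists y => e N /hy h; have [n Nn hn] := h N; exists n; rewrite // dE.
Qed.

Section Construction.
Variable f : H -> H.
Hypothesis cf : cluster_compact f.

Let F n : H -> H := iter n (fun g => deflate g (maximizer g)) f.
Let x n := maximizer (F n).
Let s n := nr (F n (x n)).

Let FS n u : F n.+1 u = F n u - dot u (x n) *: F n (x n).
Proof. by []. Qed.

Let cF n : cluster_compact (F n).
Proof.
elim: n => [//|n IHn]; apply: deflate_cluster => //.
by have [] := maximizerP IHn.
Qed.

Let F0 n : F n 0 = 0.
Proof. by have [/linear_bundle[g ->] _] := cF n; rewrite linear0. Qed.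

Let x1 n : nr (x n) = 1 \/ x n = 0.
Proof. by have [] := maximizerP (cF n). Qed.

Let x0 n : s n = 0 -> x n = 0.
Proof. by have [_ _] := maximizerP (cF n). Qed.

Let Fle n u : nr (F n u) <= s n * nr u.
Proof. by have [] := maximizerP (cF n). Qed.

Let Fdot n u : dot (F n (x n)) (F n u) = (s n ^+ 2)%:C * dot (x n) u.
Proof.
apply: (norm_attained_orthogonal hdot) => //; first by have [] := cF n.
by case: (x1 n) => xn; [rewrite xn mulr1|rewrite xn F0 nr0 mulr0].
Qed.

(** The source of the orthogonality of the maximizers: [F n] kills all earlier ones by [Fkill]. *)
Let ortho_kernel n u : F n u = 0 -> dot (x n) u = 0.
Proof.
move=> Fu; have := Fdot n u; rewrite Fu dot0r => /esym/eqP.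
rewrite mulf_eq0 => /orP[|/eqP//].
rewrite (_ : 0 = 0%:C) // => /eqP/complexI/eqP; rewrite expf_eq0 /= => /eqP/x0->.
by rewrite dot0l.
Qed.

Let Fkill n m : (m < n)%N -> F n (x m) = 0.
Proof.
elim: n => [//|n IHn]; rewrite ltnS leq_eqVlt FS => /predU1P[->|mn].
  rewrite (dotxx hdot); case: (x1 n) => [->|->]; first by rewrite expr1n scale1r subrr.
  by rewrite F0 scaler0 subrr.
by rewrite (dotC dot (x n)) // ortho_kernel ?IHn // rmorph0 scale0r subrr.
Qed.

Let x_ortho : orthosystem x.
Proof.
split=> // m n; rewrite neq_ltn => /orP[] h; last exact/ortho_kernel/Fkill.
by apply/dot_eq0_sym => //; exact/ortho_kernel/Fkill.
Qed.

Let Fperp n u : (forall m, (m < n)%N -> dot u (x m) = 0) -> F n u = f u.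
Proof.
elim: n => [//|n IHn] h; rewrite FS (h n) // scale0r subr0; apply: IHn => m mn.
by apply: h; rewrite ltnW.
Qed.

Let Fx n : F n (x n) = f (x n).
Proof. by apply: Fperp => m mn; apply: x_ortho.1; rewrite gtn_eqF. Qed.

Let tail n u : (forall m, (m < n)%N -> dot u (x m) = 0) ->
  nr (f u) <= s n * nr u.
Proof. by move=> /Fperp <-. Qed.

Let noninc m n : (m <= n)%N -> s n <= s m.
Proof.
elim: n => [|n IHn]; first by rewrite leqn0 => /eqP ->.
rewrite leq_eqVlt => /predU1P[->//|/IHn]; apply: le_trans.
rewrite /s Fx; apply: (le_trans (tail (n := n) _)).
  by move=> k kn; apply: x_ortho.1; rewrite gtn_eqF // ltnW.
by rewrite ler_piMr ?nr_ge0 // (orthosystem_le1 _ x_ortho).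
Qed.

(** On vectors orthogonal to the earlier x_k, [F n] and f agree and [Fdot] applies. On an earlier
    x_k both sides vanish, the left one by the induction hypothesis at k and conjugation. *)
Let fdot n u : dot (f (x n)) (f u) = (s n ^+ 2)%:C * dot (x n) u.
Proof.
have [/linear_bundle[g gE] _] := cf.
elim/ltn_ind: n u => n IHn u.
have [w uE wo] : exists2 w, u = w + orthoproj x n u &
    forall m, (m < n)%N -> dot w (x m) = 0.
  exists (u - orthoproj x n u); rewrite ?subrK // => m mn.
  exact: orthoproj_resid.
rewrite uE.
have -> : f (w + orthoproj x n u) = f w + \sum_(k < n) dot u (x k) *: f (x k).
  rewrite gE linearD /= /orthoproj linear_sum; congr (_ + _).
  by apply: eq_bigr => k _; rewrite linearZ.
rewrite !dotDr !dot_sumr !big1 ?addr0 //.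
- by rewrite -Fx -(Fperp (n := n) (u := w)).
- by move=> k _; rewrite dotZr x_ortho.1 ?mulr0 // gtn_eqF.
- move=> k _; rewrite dotZr //.
  have -> : dot (f (x n)) (f (x k)) = 0; last by rewrite mulr0.
  by apply/dot_eq0_sym; rewrite IHn // x_ortho.1 ?mulr0 // ltn_eqF.
Qed.

(** The images f x_n are pairwise orthogonal by [fdot] and have a cluster point, so two of them are
    within e; by Pythagoras |f x_m| is at most their distance. *)
Let small (e : R) : 0 < e -> exists n, s n < e.
Proof.
move=> e0; have e2 : 0 < e / 2 by rewrite divr_gt0.
have [_ /(_ x (fun n => orthosystem_le1 n x_ortho))[y hy]] := cf.
have [m _ hm] := hy _ 0%N e2; have [n mn hn] := hy _ m.+1 e2.
exists m; have : nr (f (x m) - f (x n)) < e.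
  have := nrD (f (x m) - y) (y - f (x n)); rewrite addrA subrK (nrB y).
  move=> h; apply: (le_lt_trans h); rewrite [ltRHS](splitr e); exact: ltrD.
apply: le_lt_trans.
rewrite -(@ler_pXn2r _ 2) ?nnegrE ?nr_ge0 // (pythagoras hdot) //.
  by rewrite nrN /s Fx lerDl sqr_ge0.
by rewrite dotNr // fdot x_ortho.1 ?mulr0 ?oppr0 // ltn_eqF.
Qed.

Lemma schmidt_exists_cluster : exists s x, schmidt f s x.
Proof.
exists s, x; split => //; first by have [] := cf.
by move=> n; rewrite /s Fx.
Qed.

End Construction.

Lemma schmidt_exists f : compact_operator f -> exists s x, schmidt f s x.
Proof. by move=> /compact_cluster; exact: schmidt_exists_cluster. Qed.

End Schmidt.

Lemma card_eq_I_proper (A B : set nat) d :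
  A `<=` B -> (A #= `I_d)%card -> (B #= `I_d)%card -> B `<=` A.
Proof.
move=> AB Ad Bd.
have finA : finite_set A by apply/finite_setP; exists d.
have finB : finite_set B by apply/finite_setP; exists d.
have sAB : (fset_set A `<=` fset_set B)%fset.
  by rewrite -fset_set_sub.
have /eqP E : fset_set A == fset_set B.
  by rewrite eqEfcard sAB (card_fset_set Ad) (card_fset_set Bd) leqnn.
move=> x Bx; have : x \in fset_set B by rewrite in_fset_set //; exact: mem_set.
by rewrite -E in_fset_set // => /set_mem.
Qed.

(** * The Schmidt numbers are the singular numbers *)

Section SingularNumbers.
Variables (R : realType) (H : completeNormedModType R[i]).
Variable dot : {dot H for (@Num.conj R[i])}.
Hypothesis hdot : forall x : H, `|x| ^+ 2 = dot x x.
Implicit Types (u v w : H).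

Lemma dot_nondegenerate v : (forall u, dot u v = 0) -> v = 0.
Proof.
move=> /(_ v); rewrite (dotxx hdot) => h; apply: nr_eq0; apply/eqP.
by rewrite -sqrf_eq0; apply/eqP/complexI.
Qed.

Lemma le_eps_mul (a K : R) : 0 <= K -> (forall e, 0 < e -> a <= e * K) -> a <= 0.
Proof.
move=> K0 h; rewrite leNgt; apply/negP => a0.
have K1 : 0 < K + 1 by rewrite ltr_wpDl.
have := h (a / (K + 1)) (divr_gt0 a0 K1).
rewrite mulrAC -ler_pdivrMr ?invr_gt0 // invrK; nra.
Qed.

Section WithSchmidt.
Variables (f : H -> H) (s : nat -> R) (x : nat -> H).
Hypothesis hs : schmidt dot f s x.

Lemma schmidt_ge0 n : 0 <= s n.
Proof. by rewrite -(schmidt_norm hs) nr_ge0. Qed.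

Lemma schmidt_unit n : s n != 0 -> nr (x n) = 1.
Proof.
have [g E] := linear_bundle (schmidt_linear hs).
move=> sn; case: ((schmidt_ortho hs).2 n) => // x0; move/eqP: sn; case.
by rewrite -(schmidt_norm hs) x0 E linear0 nr0.
Qed.

Lemma schmidt_small_near (e : R) : 0 < e ->
  exists N, forall n, (N <= n)%N -> s n < e.
Proof.
move=> /(schmidt_small hs)[N sN]; exists N => n /(schmidt_noninc hs) h.
exact: le_lt_trans sN.
Qed.

Lemma orthoproj_le n u : nr (u - orthoproj dot x n u) <= nr u.
Proof.
rewrite -(@ler_pXn2r _ 2) ?nnegrE ?nr_ge0 //.
rewrite -[X in _ <= nr X ^+ 2](subrK (orthoproj dot x n u)).
rewrite [leRHS](pythagoras hdot) ?lerDl ?sqr_ge0 //.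
exact: (orthoproj_perp hdot _ _ (fun k => dot u (x k)) (schmidt_ortho hs)).
Qed.

(** [g v] is the limit of [G v n], the sum of <v, f x_k> x_k over k < n. These sums are Cauchy
    because f is bounded by s_m on the complement of the first m vectors and s_m tends to 0. *)
Lemma adjoint_exists : exists g, forall u v, dot (f u) v = dot u (g v).
Proof.
have ox := schmidt_ortho hs.
have [f' fE] := linear_bundle (schmidt_linear hs).
have fB u v : f (u - v) = f u - f v by rewrite fE linearB.
pose c v k := dot v (f (x k)); pose G v n := \sum_(k < n) c v k *: x k.
have xG v n j : (j < n)%N -> dot (x j) (G v n) = dot (f (x j)) v.
  move=> jn; rewrite dot_sumr (bigD1 (Ordinal jn)) //= big1 ?addr0.
    rewrite dotZr (dotxx hdot) (dotC dot v (f (x j))) /c.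
    case: (ox.2 j) => [->|x0]; first by rewrite expr1n mulr1.
    by rewrite x0 fE linear0 dot0r rmorph0 mul0r.
  move=> k kj; rewrite dotZr ox.1 ?mulr0 //.
  by rewrite eq_sym; exact: kj.
(* On the span of the first n vectors, [G v n] already represents the functional u |-> <f u, v>. *)
have spanG v n m (a : nat -> R[i]) : (m <= n)%N ->
    dot (f (\sum_(k < m) a k *: x k)) v = dot (\sum_(k < m) a k *: x k) (G v n).
  move=> mn; rewrite fE linear_sum !dot_suml; apply: eq_bigr => k _.
  by rewrite linearZ /= !dotZl xG ?fE // (leq_trans _ mn).
have cauchyG v m n : (m <= n)%N -> nr (G v n - G v m) <= s m * nr v.
  move=> mn; set w := _ - _.
  have wx j : (j < m)%N -> dot w (x j) = 0.
    move=> jm; apply/dot_eq0_sym; rewrite dotBr !xG ?subrr //.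
    exact: leq_trans mn.
  have wG : dot w (G v m) = 0.
    by rewrite dot_sumr big1 // => k _; rewrite dotZr wx ?mulr0.
  (* Since w is orthogonal to [G v m], |w|^2 = <w, G v n> = <f w, v>; the tail bound for w and
     Cauchy-Schwarz conclude. *)
  have : nr w ^+ 2 <= s m * nr w * nr v.
    have E : (nr w ^+ 2)%:C = dot (f w) v.
      rewrite -(dotxx hdot) {2}/w dotBr wG subr0 /w fB dotBl.
      by rewrite (spanG v n n (c v)) // (spanG v n m (c v)) // -dotBl.
    have := CauchySchwarz hdot (f w) v.
    rewrite -E normc_real ger0_norm ?sqr_ge0 // => h; apply: (le_trans h).
    by rewrite ler_wpM2r ?nr_ge0 //; exact: (schmidt_tail hs).
  have [->|w0] := eqVneq w 0; first by rewrite nr0 mulr_ge0 ?nr_ge0 ?schmidt_ge0.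
  by rewrite expr2 mulrAC ler_pM2r // nr_gt0.
have /choice[g hg] : forall v, exists l, forall e : R, 0 < e ->
    exists n0, forall n, (n0 <= n)%N -> nr (G v n - l) < e.
  move=> v; apply: complete_seq => e e0.
  have e1 : 0 < e / (nr v + 1) by rewrite divr_gt0 // ltr_wpDl ?nr_ge0.
  have [N hN] := schmidt_small_near e1.
  suff main m n : (N <= m)%N -> (m <= n)%N -> nr (G v n - G v m) < e.
    exists N => m n Nm Nn; case/orP: (leq_total m n) => mn; last exact: main.
    by rewrite nrB; exact: main.
  move=> Nm mn; apply: (le_lt_trans (cauchyG _ _ _ mn)).
  have := hN _ Nm; rewrite ltr_pdivlMr ?ltr_wpDl ?nr_ge0 // => h.
  by apply: le_lt_trans h; rewrite ler_wpM2l ?schmidt_ge0 // lerDl.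
exists g => u v; apply/eqP; rewrite -subr_eq0; apply/eqP/Normc.eq0_normc.
apply/eqP; rewrite eq_le normc_ge0 andbT.
apply: (@le_eps_mul _ (nr u * nr v + nr u)).
  by rewrite addr_ge0 ?mulr_ge0 ?nr_ge0.
move=> e e0; have [N1 hN1] := schmidt_small_near e0.
have [N2 hN2] := hg v e e0; pose n := maxn N1 N2.
(* On the projection of u, [G v n] is exact; what remains is f on the residual, bounded by s_n, and
   the distance from [G v n] to its limit. *)
have -> : dot (f u) v - dot u (g v) =
    dot (f (u - orthoproj dot x n u)) v + dot u (G v n - g v).
  rewrite dotBr fB dotBl (spanG v n n (dot u \o x)) //.
  rewrite -[in dot u (G v n)](subrK (orthoproj dot x n u) u) dotDl.
  rewrite (_ : dot (u - _) (G v n) = 0) ?add0r; first by rewrite addrA subrK.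
  exact: (orthoproj_perp hdot _ _ (c v) ox).
apply: (le_trans (le_normcD _ _)); rewrite mulrDr; apply: lerD.
  apply: (le_trans (CauchySchwarz hdot _ _)); rewrite mulrA ler_wpM2r ?nr_ge0 //.
  apply: (le_trans (schmidt_tail hs (n := n) _)).
    by move=> m mn; rewrite (orthoproj_resid hdot _ ox).
  by apply: ler_pM; rewrite ?nr_ge0 ?schmidt_ge0 ?orthoproj_le // ltW // hN1 // leq_maxl.
apply: (le_trans (CauchySchwarz hdot _ _)); rewrite mulrC ler_wpM2r ?nr_ge0 //.
by rewrite ltW // hN2 // leq_maxr.
Qed.

Lemma adjointP u v : dot (f u) v = dot u (adjoint dot f v).
Proof.
rewrite /adjoint; case: xgetP => [g _ -> //|nex]; have [g hg] := adjoint_exists.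
by case: (nex g).
Qed.

Let E (lambda : R) := [set u | adjoint dot f (f u) = (lambda ^+ 2)%:C *: u].

Let eigenP lambda u :
  E lambda u <-> forall w, dot (f w) (f u) = (lambda ^+ 2)%:C * dot w u.
Proof.
split=> [Eu w|h]; first by rewrite adjointP Eu dotZr conjc_real.
apply/eqP; rewrite -subr_eq0; apply/eqP/dot_nondegenerate => w.
by rewrite dotBr -adjointP h dotZr conjc_real subrr.
Qed.

Let eigen_lin lambda a u v : E lambda u -> E lambda v -> E lambda (a *: u + v).
Proof.
have [g gE] := linear_bundle (schmidt_linear hs).
move=> /eigenP hu /eigenP hv; apply/eigenP => w.
move: hu hv; rewrite gE => hu hv.
by rewrite linearP dotDr dotZr hu hv dotDr dotZr mulrDr mulrCA.
Qed.

Let eigen_dot lambda u m : 0 < lambda -> E lambda u -> s m != lambda ->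
  dot u (x m) = 0.
Proof.
move=> l0 /eigenP/(_ (x m)); rewrite (schmidt_dot hs) => /eqP.
rewrite -subr_eq0 -mulrBl mulf_eq0 => /orP[|/eqP/dot_eq0_sym-> //].
rewrite -rmorphB (_ : 0 = 0%:C) // => /eqP/complexI/eqP.
by rewrite subr_eq0 eqrXn2 ?schmidt_ge0 // ?ltW // => /eqP ->; rewrite eqxx.
Qed.

Let eigen_base lambda m : s m = lambda -> E lambda (x m).
Proof.
move=> <-; apply/eigenP => w; rewrite (dotC dot (f (x m))) (schmidt_dot hs).
by rewrite rmorphM /= -dotC oppr0.
Qed.

(** The eigenspace of lambda^2 has as basis the x_m with s_m = lambda. Past some N all s_n are below
    lambda; after removal of the first N components an eigenvector r satisfies |f r| = lambda |r|
    and |f r| <= s_N |r|, so r = 0. *)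
Lemma schmidt_singular : is_singular_numbers dot f s.
Proof.
have ox := schmidt_ortho hs.
split; [exact: schmidt_ge0|exact: (schmidt_noninc hs)|] => lambda l0.
have [N hN] := schmidt_small_near l0.
pose idx := [seq m <- iota 0 N | s m == lambda].
have idx_s m : (m \in idx) = (s m == lambda).
  rewrite mem_filter mem_iota /= add0n; case: eqP => //= sm.
  by rewrite ltnNge; apply/negP => /hN; rewrite sm ltxx.
have idx_uniq : uniq idx by rewrite filter_uniq // iota_uniq.
pose e (i : 'I_(size idx)) := x (nth 0%N idx i).
have se i : s (nth 0%N idx i) = lambda \/ (size idx <= i)%N.
  case: (ltnP i (size idx)) => ii; last by right.
  by left; apply/eqP; rewrite -idx_s mem_nth.
have {}se (i : 'I_(size idx)) : s (nth 0%N idx i) = lambda.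
  by case: (se i) => // ii; have := ltn_ord i; rewrite ltnNge ii.
have eigen0 : E lambda 0.
  apply/eigenP => w; have [g ->] := linear_bundle (schmidt_linear hs).
  by rewrite linear0 !dot0r mulr0.
have eigen_sum a : E lambda (\sum_i a i *: e i).
  elim/big_ind: _ => [//|p q Ep Eq|i _].
    by rewrite -[p]scale1r; exact: eigen_lin.
  rewrite -[_ *: _]addr0; apply: eigen_lin => //; exact: eigen_base.
exists (size idx).
  exists e.
    move=> a aE j; have : dot (\sum_i a i *: e i) (e j) = 0 by rewrite aE dot0l.
    rewrite dot_suml (bigD1 j) //= big1 ?addr0.
      by rewrite dotZl (dotxx hdot) schmidt_unit ?expr1n ?mulr1 // se gt_eqF.
    move=> i ij; rewrite dotZl ox.1 ?mulr0 //.
    by rewrite nth_uniq.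
  rewrite eqEsubset; split=> u /=; last first.
    by case=> a _ <-; exact: eigen_sum.
  move=> Eu; exists (fun i => dot u (e i)) => //.
  (* The indices outside [idx] contribute nothing, since u is orthogonal to the x_m with s_m
     different from lambda. *)
  have projE : \sum_i dot u (e i) *: e i = orthoproj dot x N u.
    rewrite -(big_mkord xpredT (fun i => dot u (x (nth 0%N idx i)) *: x (nth 0%N idx i))).
    rewrite -(big_nth 0%N xpredT (fun m => dot u (x m) *: x m)) big_filter.
    rewrite /orthoproj -(big_mkord xpredT (fun m => dot u (x m) *: x m)).
    rewrite big_mkcond /index_iota subn0; apply: eq_bigr => m _.
    by case: eqP => // /eqP sm; rewrite (eigen_dot l0 Eu sm) scale0r.
  rewrite projE; set r := u - orthoproj dot x N u.
  have Er : E lambda r.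
    have -> : r = -1 *: orthoproj dot x N u + u by rewrite scaleN1r addrC.
    by apply: eigen_lin => //; rewrite -projE; exact: eigen_sum.
  have r0 : r = 0.
    apply/eqP; apply: contraT => /nr_gt0 rp.
    have /eigenP/(_ r) := Er; rewrite !(dotxx hdot) -rmorphM => /complexI.
    rewrite -exprMn => /eqP; rewrite eqrXn2 ?mulr_ge0 ?nr_ge0 // ?ltW // => /eqP fr.
    have := schmidt_tail hs (n := N) (u := r) (fun m mN => orthoproj_resid hdot u ox mN).
    by rewrite fr ler_pM2r // leNgt hN.
  by apply/esym/eqP; rewrite -subr_eq0 -/r r0.
have -> : [set n | s n = lambda] = [set` [fset n in idx]%fset].
  by apply/seteqP; split=> n /=; rewrite !inE idx_s => /eqP.
by apply/card_eq_fsetP; rewrite card_fseq undup_id.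
Qed.

(** Let n be the first index where the sequences differ, say b_n < a_n. By monotonicity b takes the
    value a_n only before n, where a agrees with b. The two level sets of a_n are then nested and
    equinumerous, hence equal, but n belongs to that of a only. *)
Lemma singular_numbers_unique t : is_singular_numbers dot f t -> t = s.
Proof.
have [s0 sm sE] := schmidt_singular; case=> t0 tm tE.
suff le1 (a b : nat -> R) n : (forall n, 0 <= a n) -> (forall n, 0 <= b n) ->
    (forall m n, (m <= n)%N -> a n <= a m) -> (forall m n, (m <= n)%N -> b n <= b m) ->
    (forall lambda, 0 < lambda -> exists d,
      ([set n | a n = lambda] #= `I_d)%card /\ ([set n | b n = lambda] #= `I_d)%card) ->
    (forall k, (k < n)%N -> a k = b k) -> a n <= b n.
  have tsE lambda : 0 < lambda -> exists d,
      ([set n | t n = lambda] #= `I_d)%card /\ ([set n | s n = lambda] #= `I_d)%card.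
    move=> l0; have [d d1 d2] := tE _ l0; have [d' d1' d2'] := sE _ l0.
    by exists d; rewrite {2}(dim_unique d1 d1').
  apply/funext => n; elim/ltn_ind: n => n IHn; apply/eqP; rewrite eq_le; apply/andP; split.
    exact: le1.
  apply: le1 => // [lambda l0|k kn]; last by rewrite IHn.
  by have [d [h1 h2]] := tsE _ l0; exists d.
move=> a0 b0 am bm cardE ab; rewrite leNgt; apply/negP => ban.
have an0 : 0 < a n by apply: le_lt_trans ban.
have [d [ad bd]] := cardE _ an0.
suff /card_eq_I_proper/(_ bd ad n erefl) /= : [set m | b m = a n] `<=` [set m | a m = a n].
  by move=> h; move: ban; rewrite h ltxx.
move=> m /= bman; rewrite ab // ltnNge; apply/negP => /bm.
by rewrite bman leNgt ban.
Qed.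

Lemma schmidt_singular_numbers : singular_numbers dot f = s.
Proof.
rewrite /singular_numbers; case: xgetP => [t _ /singular_numbers_unique//|nex].
by case: (nex s); exact: schmidt_singular.
Qed.

End WithSchmidt.
End SingularNumbers.

Lemma ultra_compact_cvg (T : Type) (U : topologicalType) (F : set_system T)
    (f : T -> U) (K : set U) :
  UltraFilter F -> compact K -> F (f @^-1` K) ->
  exists2 z, K z & f @ F --> z.
Proof.
move=> UF cK FK; have [z [Kz fz]] : K `&` cluster (f @ F) !=set0 by exact: cK.
exists z => // B zB; have [//|FC] := in_ultra_setVsetC (f @^-1` B) UF.
by have [w [wC /wC]] := fz (~` B) B FC zB.
Qed.

(** * Compact operators: combinations, rank one operators and limits *)

Section Compactness.
Variables (R : realType) (H : completeNormedModType R[i]).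
Implicit Types (x y z u v w : H).

(** Send each point y of the closure to a point p(y) of the compact set within 2e/3. Along the
    ultrafilter p converges to some z, so most p(y) are within e/3 of z and most y within e. *)
Lemma ultra_cauchy_approx (F : set_system H) (A : set H) :
  UltraFilter F -> F (closure A) ->
  (forall e : R, 0 < e -> exists2 K : set H, compact K &
    forall y, A y -> exists2 z, K z & nr (y - z) < e) ->
  cvg F.
Proof.
move=> UF FA approx; apply/cauchy_cvgP/cauchyP => -[e0 i0].
rewrite ltcE /= => /andP[/eqP i0E e0p].
have -> : e0 +i* i0 = e0%:C by rewrite i0E.
have e3 : 0 < e0 / 3 by rewrite divr_gt0.
have [K cK AK] := approx _ e3.
have /choice[p hp] : forall y, exists z, closure A y -> K z /\ nr (y - z) < e0 / 3 * 2.
  move=> y; case: (pselect (closure A y)) => [Ay|]; last by exists 0.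
  have [|y' [Ay' /nr_ball h]] := Ay (ball y (e0 / 3)%:C).
    by apply: nbhsx_ballx; rewrite ltcR.
  have [z Kz yz] := AK _ Ay'; exists z => _; split => //.
  have := nrD (y - y') (y' - z); rewrite addrA subrK (nrB y).
  by have := h e3; lra.
have [z Kz pz] : exists2 z, K z & p @ F --> z.
  by apply: ultra_compact_cvg cK _; apply: (@filterS _ F _ (closure A)) => // y /hp[].
have FB : F (p @^-1` ball z (e0 / 3)%:C).
  by apply: (pz (ball z _)); apply: nbhsx_ballx; rewrite ltcR.
exists z.
apply: filterS (filterI FA FB) => y [Ay /nr_ball] /(_ e3) h; apply/nr_ball => //.
have := nrD (y - p y) (p y - z); rewrite addrA subrK.
by have [_] := hp _ Ay; lra.
Qed.

Lemma approx_compact_precompact (A : set H) :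
  (forall e : R, 0 < e -> exists2 K : set H, compact K &
    forall y, A y -> exists2 z, K z & nr (y - z) < e) -> precompact A.
Proof.
move=> approx; rewrite precompactE compact_ultra => F UF FA.
have /cvg_ex[p Fp] := ultra_cauchy_approx UF FA approx.
exists p; split => //; apply: closed_closure => B /Fp FB.
exact: filter_ex (filterI FA FB).
Qed.

Lemma compact_sum (A B : set H) : compact A -> compact B ->
  compact [set x + y | x in A & y in B].
Proof.
move=> cA cB; have -> : [set x + y | x in A & y in B] =
    (fun p : H * H => p.1 + p.2) @` (A `*` B).
  apply/seteqP; split => [_ [x Ax [y By <-]]|_ [[x y] [/= Ax By] <-]].
    by exists (x, y).
  by exists x => //; exists y.
apply: continuous_compact; last exact: compact_setX.
by apply: continuous_subspaceT; exact: add_continuous.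
Qed.

Lemma compact_scale (a : R[i]) (A : set H) : compact A ->
  compact [set a *: x | x in A].
Proof.
move=> cA; apply: continuous_compact => //; apply: continuous_subspaceT.
exact: scaler_continuous.
Qed.

Lemma compact_hausdorff_precompact (A B : set H) :
  A `<=` B -> compact B -> precompact A.
Proof.
by move=> AB cB; apply: (precompact_subset AB); exact: compact_precompact.
Qed.

Lemma compact_operatorP (a : R[i]) (f g : H -> H) :
  compact_operator f -> compact_operator g -> compact_operator (a *: f + g).
Proof.
case=> lf; rewrite precompactE => cf [lg]; rewrite precompactE => cg.
split.
  have fgE u : (a *: f + g) u = a *: f u + g u by [].
  move=> b u v; rewrite !fgE lf lg !scalerDr !scalerA (mulrC a).
  by rewrite addrACA.
apply: (compact_hausdorff_precompact _ (compact_sum (compact_scale cf) cg)).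
move=> _ [u u1 <-]; exists (a *: f u).
  by exists (f u) => //; apply: subset_closure; exists u.
by exists (g u) => //; apply: subset_closure; exists u.
Qed.

Lemma segment_scale_compact (M : R) x :
  compact [set t%:C *: x | t in `[- M, M]%classic].
Proof.
apply: continuous_compact; last exact: segment_compact.
apply: continuous_subspaceT => t; apply/cvgrPdist_lt => -[e i].
rewrite ltcE /= => /andP[/eqP -> e0].
have e1 : 0 < e / (nr x + 1) by rewrite divr_gt0 // ltr_wpDl ?nr_ge0.
near=> r.
rewrite -scalerBl nrC ltcR -rmorphB nrZ normc_real.
have : `|t - r| < e / (nr x + 1) by near: r; apply: cvgr_dist_lt.
rewrite ltr_pdivlMr ?ltr_wpDl ?nr_ge0 // => h; apply: le_lt_trans h.
by rewrite ler_wpM2l // lerDl.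
Unshelve. all: by end_near. Qed.

Variable dot : {dot H for (@Num.conj R[i])}.
Hypothesis hdot : forall x : H, `|x| ^+ 2 = dot x x.

(** The image of the unit ball lies in the sum of two compact segments, the bounded real multiples
    of y and of iy. *)
Lemma rank_one_compact x y : compact_operator (fun u => dot u x *: y).
Proof.
split=> [a u v|]; first by rewrite dotDl dotZl scalerDl scalerA.
apply: (compact_hausdorff_precompact _
  (compact_sum (@segment_scale_compact (nr x) y)
     (@segment_scale_compact (nr x) ('i%C *: y)))).
move=> _ [u /= u1 <-]; rewrite nrC lecR in u1.
have bnd : normc (dot u x) <= nr x.
  by apply: (le_trans (CauchySchwarz hdot _ _)); rewrite ler_piMl // nr_ge0.
exists ((Re (dot u x))%:C *: y).
  by exists (Re (dot u x)) => //=; rewrite in_itv /= -ler_norml (le_trans (normc_Re _)).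
exists ((Im (dot u x))%:C *: ('i%C *: y)).
  exists (Im (dot u x)) => //=; rewrite in_itv /= -ler_norml.
  by rewrite (le_trans (normc_Im _)).
by rewrite scalerA -scalerDl mulrC -complexE.
Qed.

Lemma compact_operator_limit (f : H -> H) : linear f ->
  (forall e : R, 0 < e -> exists2 g, compact_operator g &
    forall u, nr (f u - g u) <= e * nr u) ->
  compact_operator f.
Proof.
move=> lf lim_f; split => //; apply: approx_compact_precompact => e e0.
have e2 : 0 < e / 2 by rewrite divr_gt0.
have [g [lg]] := lim_f _ e2; rewrite precompactE => cg fg.
exists (closure (g @` [set x | `|x| <= 1])) => // _ [u /= u1 <-].
exists (g u); first by apply: subset_closure; exists u.
rewrite nrC lecR in u1; apply: le_lt_trans (fg u) _.
have : e / 2 * nr u <= e / 2 by rewrite ler_piMr // ltW.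
by move=> h; apply: (le_lt_trans h); rewrite ltr_pdivrMr // ltr_pMr // ltr1n.
Qed.

End Compactness.

(** * Powers with exponent at most 1, and series of nonnegative terms *)

Section RealPowers.
Variable R : realType.
Implicit Types (a b p e : R).

Lemma ler_powRl p a b : 0 <= p -> 0 <= a -> a <= b -> a `^ p <= b `^ p.
Proof.
move=> p0 a0 ab; apply: ge0_ler_powR => //; rewrite nnegrE //; exact: le_trans ab.
Qed.

Lemma powRK p a : 0 < p -> 0 <= a -> (a `^ p) `^ p^-1 = a.
Proof. by move=> p0 a0; rewrite -powRrM divff ?gt_eqF // powRr1. Qed.

Lemma powRVK p a : 0 < p -> 0 <= a -> (a `^ p^-1) `^ p = a.
Proof. by move=> p0 a0; rewrite -powRrM mulVf ?gt_eqF // powRr1. Qed.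

Lemma ler_powRl_inv p a b : 0 < p -> 0 <= a -> 0 <= b -> a `^ p <= b `^ p -> a <= b.
Proof.
move=> p0 a0 b0 h; rewrite -(powRK p0 a0) -(powRK p0 b0).
by apply: ler_powRl; rewrite ?powR_ge0 // ltW // invr_gt0.
Qed.

(** A ratio t in [0, 1] satisfies t <= t^p; take t = a / (a + b) and t = b / (a + b), whose sum is
    1, and multiply by (a + b)^p. *)
Lemma powR_subadd p a b : 0 < p -> p <= 1 -> 0 <= a -> 0 <= b ->
  (a + b) `^ p <= a `^ p + b `^ p.
Proof.
move=> p0 p1 a0 b0.
have [->|an] := eqVneq a 0; first by rewrite add0r powR0 ?gt_eqF // add0r.
have ap : 0 < a by rewrite lt_neqAle eq_sym an.
have abp : 0 < a + b by rewrite ltr_pwDl.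
have le_frac c : 0 <= c -> c <= a + b -> c / (a + b) * (a + b) `^ p <= c `^ p.
  move=> c0 cab; have [->|cn] := eqVneq c 0; first by rewrite !mul0r powR_ge0.
  have cp : 0 < c by rewrite lt_neqAle eq_sym cn.
  rewrite -{2}(divfK (lt0r_neq0 abp) c) (powRM _ (divr_ge0 c0 (ltW abp)) (ltW abp)).
  rewrite ler_pM2r ?powR_gt0 // -{1}(powRr1 (divr_ge0 c0 (ltW abp))).
  by apply: ger_powR => //; rewrite divr_gt0 //= ler_pdivrMr // mul1r.
have := lerD (le_frac a a0 _) (le_frac b b0 _).
rewrite -mulrDl -mulrDl divff ?gt_eqF // mul1r; apply; [by rewrite lerDl|by rewrite lerDr].
Qed.

Lemma powR_sum_le p (s : nat -> R) N : 0 < p -> p < 1 -> (forall n, 0 <= s n) ->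
  \sum_(n < N) s n <= (\sum_(n < N) s n `^ p) `^ p^-1.
Proof.
move=> p0 p1 s0; elim: N => [|N IHN].
  by rewrite !big_ord0 powR_ge0.
rewrite !big_ord_recr /=; apply: (@ler_powRl_inv p) => //.
- by rewrite addr_ge0 ?sumr_ge0.
- by rewrite powR_ge0.
rewrite powRVK ?addr_ge0 ?powR_ge0 ?sumr_ge0 // => [|i _]; last exact: powR_ge0.
apply: (le_trans (powR_subadd p0 (ltW p1) _ (s0 N))); first by rewrite sumr_ge0.
rewrite lerD2r -[leRHS](powRVK p0); last by rewrite sumr_ge0 // => i _; exact: powR_ge0.
by apply: ler_powRl => //; rewrite ?(ltW p0) ?sumr_ge0.
Qed.

(** Serves the quasi-triangle inequality: s_(2k)(f + g) <= s_k(f) + s_k(g) controls the even indices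
    only. *)
Lemma sum_le_even (a : nat -> R) N : (forall m n, (m <= n)%N -> a n <= a m) ->
  (forall n, 0 <= a n) ->
  \sum_(k < N) a k <= 2 * \sum_(k < N) a k.*2.
Proof.
move=> am a0; apply: (@le_trans _ _ (\sum_(k < N.*2) a k)).
  by rewrite -addnn big_split_ord /= lerDl sumr_ge0.
elim: N => [|N IHN]; first by rewrite !big_ord0 mulr0.
rewrite doubleS !big_ord_recr /= mulrDr -addrA; apply: lerD => //.
by rewrite mulr_natl mulr2n lerD2l am.
Qed.

Lemma two_add_le a b (c : R) : a <= c -> b <= c -> 2 * (a + b) <= 4 * c.
Proof. lra. Qed.

Lemma series_nondecreasing (a : nat -> R) : (forall n, 0 <= a n) ->
  nondecreasing_seq (series a).
Proof.
move=> a0; apply/nondecreasing_seqP => n.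
by rewrite !seriesEord /= big_ord_recr /= lerDl.
Qed.

Lemma series_bounded (a : nat -> R) B : (forall n, 0 <= a n) ->
  (forall N, \sum_(k < N) a k <= B) -> cvgn (series a) /\ limn (series a) <= B.
Proof.
move=> a0 aB; have aB' N : series a N <= B by rewrite seriesEord; exact: aB.
have ca : cvgn (series a).
  apply: nondecreasing_is_cvgn; first exact: series_nondecreasing.
  by exists B => _ [N _ <-].
by split => //; apply: limr_le => //; exact: nearW.
Qed.

Lemma series_partial_le (a : nat -> R) N : (forall n, 0 <= a n) ->
  cvgn (series a) -> \sum_(k < N) a k <= limn (series a).
Proof.
move=> /series_nondecreasing nd ca.
by have := nondecreasing_cvgn_le nd ca N; rewrite {1}seriesEord.
Qed.

End RealPowers.

(** * The quasi Banach space structure of the Schatten class *)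

Section SchattenClass.
Variables (R : realType) (H : completeNormedModType R[i]).
Variable dot : {dot H for (@Num.conj R[i])}.
Hypothesis hdot : forall x : H, `|x| ^+ 2 = dot x x.
Implicit Types (u v w : H) (f g : H -> H).

Local Notation sn := (singular_numbers dot).

Lemma schmidtP f : compact_operator f -> exists x, schmidt dot f (sn f) x.
Proof.
move=> /(schmidt_exists hdot)[s [x hs]]; exists x.
by rewrite (schmidt_singular_numbers hdot hs).
Qed.

Lemma sn_ge0 f n : compact_operator f -> 0 <= sn f n.
Proof. by move=> /schmidtP[x hs]; exact: schmidt_ge0 hs n. Qed.

Lemma sn_noninc f m n : compact_operator f -> (m <= n)%N -> sn f n <= sn f m.
Proof. by move=> /schmidtP[x hs]; exact: schmidt_noninc hs m n. Qed.

Lemma sn0_bound f u : compact_operator f -> nr (f u) <= sn f 0 * nr u.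
Proof. by move=> /schmidtP[x hs]; apply: (schmidt_tail hs). Qed.

(* Courant-Fischer: among the combinations of the first n + 1 singular vectors
   there is a nonzero one orthogonal to n given vectors. *)
Lemma sn_le f (v : seq H) (c : R) : compact_operator f -> 0 <= c ->
  (forall u, (forall y, y \in v -> dot u y = 0) -> nr (f u) <= c * nr u) ->
  sn f (size v) <= c.
Proof.
move=> /schmidtP[x hs] c0 fc; set n := size v; set s := sn f.
have [->//|sn0] := eqVneq (s n) 0.
have sge k : 0 <= s k := schmidt_ge0 hs k.
have snp : 0 < s n by rewrite lt_neqAle eq_sym sn0 sge.
have ox := schmidt_ortho hs.
have x1 k : (k <= n)%N -> nr (x k) = 1.
  move=> kn; apply: (schmidt_unit hs); rewrite gt_eqF //.
  exact: lt_le_trans snp (schmidt_noninc hs kn).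
have [a [i0 ai0] aM] := exists_kernel
  (fun (i : 'I_n.+1) (j : 'I_n) => dot (x i) (nth 0 v j)) (ltnSn n).
pose b k := if insub k is Some i then a i else 0.
have bE (i : 'I_n.+1) : b i = a i by rewrite /b valK.
pose u := \sum_(k < n.+1) b k *: x k.
have uv y : y \in v -> dot u y = 0.
  move=> yv; have iv : (index y v < n)%N by rewrite index_mem.
  rewrite -(aM (Ordinal iv)) dot_suml; apply: eq_bigr => i _.
  by rewrite dotZl bE /= nth_index.
have u2 : nr u ^+ 2 = \sum_(k < n.+1) normc (b k) ^+ 2.
  apply: (orthosum_norm hdot ox) => k; rewrite ltnS => /x1 + x0.
  by rewrite x0 nr0 => /esym/eqP; rewrite oner_eq0.
have fu2 : nr (f u) ^+ 2 = \sum_(k < n.+1) s k ^+ 2 * normc (b k) ^+ 2.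
  apply: complexI; rewrite -(dotxx hdot) rmorph_sum /=.
  have [f' fE] := linear_bundle (schmidt_linear hs).
  have -> : f u = \sum_(k < n.+1) b k *: f (x k).
    by rewrite fE linear_sum; apply: eq_bigr => k _; rewrite linearZ.
  rewrite dot_suml; apply: eq_bigr => k _.
  have -> : \sum_(k < n.+1) b k *: f (x k) = f u.
    by rewrite fE linear_sum; apply: eq_bigr => l _; rewrite linearZ.
  rewrite dotZl (schmidt_dot hs) dot_sumr (bigD1 k) //= big1 ?addr0; last first.
    by move=> l lk; rewrite dotZr ox.1 ?mulr0 // eq_sym; exact: lk.
  rewrite dotZr (dotxx hdot) (x1 _ (leq_ord k)) expr1n mulr1.
  by rewrite mulrCA (mulrC (b k)) mulcJ -rmorphM.
have up : 0 < nr u ^+ 2.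
  rewrite u2 (bigD1 i0) //= bE ltr_pwDl ?sumr_ge0 //; last by move=> *; exact: sqr_ge0.
  by rewrite exprn_gt0 ?normc_gt0.
have le1 : s n ^+ 2 * nr u ^+ 2 <= nr (f u) ^+ 2.
  rewrite u2 fu2 mulr_sumr; apply: ler_sum => k _.
  apply: ler_wpM2r; first exact: sqr_ge0.
  by rewrite ler_pXn2r ?nnegrE // (schmidt_noninc hs) // -ltnS ltn_ord.
have le2 : nr (f u) ^+ 2 <= c ^+ 2 * nr u ^+ 2.
  by rewrite -exprMn ler_pXn2r ?nnegrE ?mulr_ge0 ?nr_ge0 //; exact: fc.
have := le_trans le1 le2; rewrite ler_pM2r // ler_pXn2r ?nnegrE //.
Qed.

Lemma compact_operatorD f g :
  compact_operator f -> compact_operator g -> compact_operator (f + g).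
Proof. by move=> cf cg; rewrite -[f]scale1r; exact: compact_operatorP. Qed.

Lemma compact_operator0 : compact_operator (0 : H -> H).
Proof.
have -> : (0 : H -> H) = (fun u => dot u 0 *: 0) by apply/funext => u; rewrite scaler0.
exact: rank_one_compact.
Qed.

Lemma compact_operatorZ a f : compact_operator f -> compact_operator (a *: f).
Proof.
by move=> cf; rewrite -[_ *: _]addr0; apply: compact_operatorP compact_operator0.
Qed.

(** Orthogonality to the first m singular vectors of f and the first n of g amounts to m + n
    conditions, under which both tail bounds hold. *)
Lemma snD f g m n : compact_operator f -> compact_operator g ->
  sn (f + g) (m + n) <= sn f m + sn g n.
Proof.
move=> cf cg; have [x hx] := schmidtP cf; have [y hy] := schmidtP cg.
pose v := [seq x k | k <- iota 0 m] ++ [seq y k | k <- iota 0 n].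
have <- : size v = (m + n)%N by rewrite size_cat !size_map !size_iota.
apply: sn_le; [exact: compact_operatorD|by rewrite addr_ge0 ?sn_ge0|] => u uv.
apply: (le_trans (nrD _ _)); rewrite mulrDl; apply: lerD.
  apply: (schmidt_tail hx) => k km; apply: uv; rewrite mem_cat map_f //.
  by rewrite mem_iota.
apply: (schmidt_tail hy) => k kn; apply: uv; rewrite mem_cat orbC map_f //.
by rewrite mem_iota.
Qed.

Lemma snZ a f n : compact_operator f -> sn (a *: f) n <= normc a * sn f n.
Proof.
move=> cf; have [x hx] := schmidtP cf.
rewrite -{1}(size_iota 0 n) -(size_map x).
apply: sn_le; [exact: compact_operatorZ|by rewrite mulr_ge0 ?normc_ge0 ?sn_ge0|].
move=> u uv; rewrite nrZ -mulrA ler_wpM2l ?normc_ge0 //.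
by apply: (schmidt_tail hx) => k kn; apply: uv; rewrite map_f // mem_iota.
Qed.

Variable p : R.
Hypotheses (p_gt0 : 0 < p) (p_lt1 : p < 1).

Local Notation S := (schatten dot p).
Local Notation N := (schatten_norm dot p).

Lemma schatten_norm_ge0 f : 0 <= N f.
Proof. exact: powR_ge0. Qed.

Lemma schatten_bounded f B : compact_operator f -> 0 <= B ->
  (forall n, \sum_(k < n) sn f k `^ p <= B `^ p) -> S f /\ N f <= B.
Proof.
move=> cf B0 hB; have [] := series_bounded (fun n => powR_ge0 (sn f n) p) hB.
move=> cvs lims; split => //; rewrite /schatten_norm -[leRHS](powRK p_gt0 B0).
apply: ler_powRl lims; first by rewrite invr_ge0 ltW.
by have := series_partial_le 0 (fun n => powR_ge0 (sn f n) p) cvs; rewrite big_ord0.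
Qed.

Lemma schatten_partial f n : S f -> \sum_(k < n) sn f k `^ p <= N f `^ p.
Proof.
case=> cf cvs; have le1 m := series_partial_le m (fun n => powR_ge0 (sn f n) p) cvs.
by rewrite powRVK //; have := le1 0%N; rewrite big_ord0.
Qed.

Lemma sn_le_norm f n : S f -> sn f n <= N f.
Proof.
move=> Sf; have cf := Sf.1; apply: (le_trans (sn_noninc cf (leq0n n))).
apply: (@ler_powRl_inv _ p) => //; [exact: sn_ge0|exact: schatten_norm_ge0|].
by have := schatten_partial 1 Sf; rewrite big_ord1.
Qed.

Lemma schatten_norm_bound f u : S f -> nr (f u) <= N f * nr u.
Proof.
move=> Sf; apply: (le_trans (sn0_bound u Sf.1)).
by rewrite ler_wpM2r ?nr_ge0 // sn_le_norm.
Qed.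

Lemma sn_sum_le f n : S f -> \sum_(k < n) sn f k <= N f.
Proof.
move=> Sf; apply: (le_trans (powR_sum_le _ p_gt0 p_lt1 _)).
  by move=> k; exact: sn_ge0 Sf.1.
rewrite -[leRHS](powRK p_gt0 (schatten_norm_ge0 f)).
apply: ler_powRl; first by rewrite invr_ge0 ltW.
  by rewrite sumr_ge0 // => k _; exact: powR_ge0.
exact: schatten_partial.
Qed.

(** In the p-th powers, one factor 2 of the 4 comes from keeping only even indices, the other from
    a^p + b^p <= 2 (a + b)^p. *)
Lemma schattenD f g : S f -> S g ->
  S (f + g) /\ N (f + g) <= 4 `^ p^-1 * (N f + N g).
Proof.
move=> Sf Sg; have cf := Sf.1; have cg := Sg.1; have cfg := compact_operatorD cf cg.
have NN : 0 <= N f + N g by rewrite addr_ge0 // schatten_norm_ge0.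
apply: schatten_bounded => // [|n].
  by rewrite mulr_ge0 ?powR_ge0.
apply: (le_trans (sum_le_even (a := fun k => sn (f + g) k `^ p) _ _ _)).
- by move=> k l kl; apply: ler_powRl (sn_noninc _ kl); rewrite ?(ltW p_gt0) ?sn_ge0.
- by move=> k; exact: powR_ge0.
rewrite powRM ?powR_ge0 // powRVK //.
apply: (@le_trans _ _ (2 * (N f `^ p + N g `^ p))); last first.
  apply: two_add_le; apply: ler_powRl; rewrite ?(ltW p_gt0) ?schatten_norm_ge0 //.
    by rewrite lerDl schatten_norm_ge0.
  by rewrite lerDr schatten_norm_ge0.
rewrite ler_pM2l //; apply: (le_trans _ (lerD (schatten_partial n Sf) (schatten_partial n Sg))).
rewrite -big_split /=; apply: ler_sum => k _.
apply: (le_trans _ (powR_subadd p_gt0 (ltW p_lt1) (sn_ge0 _ cf) (sn_ge0 _ cg))).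
apply: ler_powRl; [exact: ltW|exact: sn_ge0|].
by rewrite -addnn snD.
Qed.

Lemma schattenZ_le a f : S f -> S (a *: f) /\ N (a *: f) <= normc a * N f.
Proof.
move=> Sf; have cf := Sf.1; apply: (@schatten_bounded (a *: f)).
- exact: compact_operatorZ.
- by rewrite mulr_ge0 ?normc_ge0 ?schatten_norm_ge0.
move=> n; rewrite powRM ?normc_ge0 ?schatten_norm_ge0 //.
apply: (le_trans _ (ler_wpM2l (powR_ge0 _ _) (schatten_partial n Sf))).
rewrite mulr_sumr; apply: ler_sum => k _.
rewrite -powRM ?normc_ge0 ?sn_ge0 //; apply: ler_powRl; rewrite ?(ltW p_gt0) //.
  exact/sn_ge0/compact_operatorZ.
exact: snZ.
Qed.

Lemma schatten0 : S 0.
Proof.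
apply: (proj1 (@schatten_bounded 0 0 compact_operator0 (lexx 0) _)) => n.
rewrite powR0 ?gt_eqF // big1 // => k _.
suff -> : sn 0 k = 0 by rewrite powR0 // gt_eqF.
apply/eqP; rewrite eq_le sn_ge0 ?andbT; last exact: compact_operator0.
apply: (le_trans (sn_noninc compact_operator0 (leq0n k))).
apply: (sn_le (v := [::])) => //; first exact: compact_operator0.
by move=> u _; rewrite nr0 mul0r.
Qed.

Lemma schatten_lin a f g : S f -> S g -> S (a *: f + g).
Proof. by move=> Sf Sg; apply: (schattenD _ Sg).1; exact: (schattenZ_le a Sf).1. Qed.

Lemma schattenZ a f : S f -> N (a *: f) = normc a * N f.
Proof.
move=> Sf; have [Saf le1] := schattenZ_le a Sf.
apply/eqP; rewrite eq_le le1 /=; have [a0|a0] := eqVneq a 0.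
  by rewrite a0 Normc.normc0 mul0r schatten_norm_ge0.
have na := normc_gt0 a0.
have [_] := schattenZ_le a^-1 Saf; rewrite scalerA mulVf // scale1r Normc.normcV.
by rewrite mulrC ler_pdivlMr // mulrC.
Qed.

Lemma schattenN f : S f -> N (- f) = N f.
Proof.
by move=> Sf; rewrite -scaleN1r schattenZ // normcN Normc.normc1 mul1r.
Qed.

Lemma schattenB f g : S f -> S g -> S (f - g).
Proof. by move=> Sf Sg; rewrite addrC -scaleN1r; exact: schatten_lin. Qed.

Lemma schatten_quasinormed : is_quasinormed S N.
Proof.
split.
- exact: schatten0.
- by move=> a f g; exact: schatten_lin.
- by move=> f _; exact: schatten_norm_ge0.
- move=> f Sf Nf0; apply/funext => u; apply: nr_eq0; apply/eqP.
  by rewrite eq_le nr_ge0 andbT -(mul0r (nr u)) -Nf0 schatten_norm_bound.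
- by move=> a f; exact: schattenZ.
- by exists (4 `^ p^-1) => f g Sf Sg; have [] := schattenD Sf Sg.
Qed.

(** The norm of S^p dominates the operator norm, so the sequence converges to a compact f in
    operator norm. Finitely many singular numbers of f - u_n are then compared with those of u_m -
    u_n for m large, and the bounds on partial sums pass to the limit. *)
Lemma schatten_complete : quasinorm_complete S N.
Proof.
move=> u Su cu.
have /choice[f hf] : forall x, exists l, forall e : R, 0 < e ->
    exists n0, forall n, (n0 <= n)%N -> nr (u n x - l) < e.
  move=> x; apply: complete_seq => e e0.
  have e1 : 0 < e / (nr x + 1) by rewrite divr_gt0 // ltr_wpDl ?nr_ge0.
  have [n0 hn0] := cu _ e1; exists n0 => m n n0m n0n.
  apply: (le_lt_trans (schatten_norm_bound x (schattenB (Su m) (Su n)))).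
  have := hn0 _ _ n0m n0n; rewrite ltr_pdivlMr ?ltr_wpDl ?nr_ge0 //.
  by apply: le_lt_trans; rewrite ler_wpM2l ?schatten_norm_ge0 // lerDl.
have fu e n0 : (forall m n, (n0 <= m)%N -> (n0 <= n)%N -> N (u m - u n) < e) ->
    forall n x, (n0 <= n)%N -> nr (f x - u n x) <= e * nr x.
  move=> h n x n0n; apply/ler_addgt0Pr => d d0; have [n1 hn1] := hf x d d0.
  pose m := maxn n0 n1; have := hn1 m (leq_maxr _ _).
  have := nrD (f x - u m x) (u m x - u n x); rewrite addrA subrK (nrB (f x) (u m x)).
  have := schatten_norm_bound x (schattenB (Su m) (Su n)).
  have : N (u m - u n) * nr x <= e * nr x.
    by rewrite ler_wpM2r ?nr_ge0 // ltW // h ?leq_maxl.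
  have -> : (u m - u n) x = u m x - u n x by [].
  lra.
have fu' e : 0 < e -> exists n0, forall n x, (n0 <= n)%N -> nr (f x - u n x) <= e * nr x.
  by move=> e0; have [n0 /fu] := cu _ e0; exists n0.
have linf : linear f.
  move=> a x y; apply/eqP; rewrite -subr_eq0; apply/eqP/nr_eq0/eqP.
  rewrite eq_le nr_ge0 andbT.
  apply: (@le_eps_mul _ _ (nr (a *: x + y) + (normc a * nr x + nr y))).
    by rewrite !addr_ge0 ?mulr_ge0 ?normc_ge0 ?nr_ge0.
  move=> e /fu'[n0 hn0]; have h z := hn0 n0 z (leqnn _).
  have lu : linear (u n0) := (Su n0).1.1.
  have -> : f (a *: x + y) - (a *: f x + f y) =
      (f (a *: x + y) - u n0 (a *: x + y)) - (a *: (f x - u n0 x) + (f y - u n0 y)).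
    rewrite lu scalerBr addrACA -opprD opprB addrA subrK //.
  apply: (le_trans (nrD _ _)); rewrite nrN !mulrDr; apply: lerD => //.
  apply: (le_trans (nrD _ _)); apply: lerD => //.
  by rewrite nrZ mulrCA ler_wpM2l ?normc_ge0.
have cf : compact_operator f.
  apply: compact_operator_limit => // e /fu'[n0 hn0].
  by exists (u n0); [exact: (Su n0).1|move=> x; exact: hn0].
have fuS e n0 : 0 < e ->
    (forall m n, (n0 <= m)%N -> (n0 <= n)%N -> N (u m - u n) < e) ->
    forall n, (n0 <= n)%N -> S (f - u n) /\ N (f - u n) <= e.
  move=> e0 h n n0n.
  have cfu m : compact_operator (f - u m).
    by rewrite addrC -scaleN1r; apply: compact_operatorP => //; exact: (Su m).1.
  apply: schatten_bounded => // [|K]; first exact: ltW.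
  rewrite -subr_le0; apply: (@le_eps_mul _ _ K%:R) => // eta eta0.
  (* An operator norm error of eta^(1/p) costs eta in the p-th power of each singular number, hence
     eta K in a sum of K terms. *)
  have d0 : 0 < eta `^ p^-1 by rewrite powR_gt0.
  have [n1 hn1] := fu' _ d0; pose m := maxn n0 n1.
  have sm : sn (f - u m) 0 <= eta `^ p^-1.
    apply: (sn_le (v := [::])) => //; first exact: ltW.
    by move=> x _; apply: hn1; exact: leq_maxr.
  have Smn := schattenB (Su m) (Su n).
  rewrite lerBlDr; apply: (@le_trans _ _ (\sum_(k < K) (eta + sn (u m - u n) k `^ p))).
    apply: ler_sum => k _.
    have := snD 0 k (cfu m) Smn.1; rewrite add0n addrA subrK => le1.
    have le2 : sn (f - u n) k <= eta `^ p^-1 + sn (u m - u n) k.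
      by apply: (le_trans le1); rewrite lerD2r.
    have le3 := ler_powRl (ltW p_gt0) (sn_ge0 k (cfu n)) le2.
    have := powR_subadd p_gt0 (ltW p_lt1) (ltW d0) (sn_ge0 k Smn.1).
    by rewrite (@powRVK _ p eta p_gt0 (ltW eta0)); exact: le_trans.
  rewrite big_split /= sumr_const card_ord mulr_natr lerD2l.
  apply: (le_trans (schatten_partial K Smn)).
  by apply: ler_powRl; rewrite ?(ltW p_gt0) ?schatten_norm_ge0 // ltW // h // leq_maxl.
have Sf : S f.
  have [n0 hn0] := cu _ ltr01.
  rewrite -(subrK (u n0) f); apply: (schattenD _ (Su n0)).1.
  by apply: (fuS _ _ ltr01 hn0 _ (leqnn _)).1.
exists f => //; apply/cvgr0Pnorm_le => e e0; have [n0 hn0] := cu _ e0.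
exists n0 => // n /= n0n; have [Sfu le1] := fuS _ _ e0 hn0 _ n0n.
by rewrite (ger0_norm (schatten_norm_ge0 (u n - f))) -(opprB f) (schattenN Sfu).
Qed.

End SchattenClass.

(** * Linear extension and generalized limits *)

Lemma linear_extension (K : fieldType) (V : lmodType K) (G0 : set (V * K)) :
  G0 (0, 0) ->
  (forall a x y c d, G0 (x, c) -> G0 (y, d) -> G0 (a *: x + y, a * c + d)) ->
  (forall c, G0 (0, c) -> c = 0) ->
  exists L : V -> K, (forall a x y, L (a *: x + y) = a * L x + L y) /\
    forall x c, G0 (x, c) -> L x = c.
Proof.
move=> G00 G0lin G0fun.
(* Zorn's lemma is applied to graphs of partial linear maps. The union of the empty chain must
   satisfy [P] too, so containing [G0] is demanded of nonempty graphs only. *)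
pose P (G : set (V * K)) :=
  [/\ forall a x y c d, G (x, c) -> G (y, d) -> G (a *: x + y, a * c + d),
      forall c, G (0, c) -> c = 0 & G !=set0 -> G0 `<=` G].
have [G [[Glin Gfun GG0] Gmax]] : exists G, P G /\ forall B, G `<` B -> ~ P B.
  apply: Zorn_bigcup => F FP Ftot; split.
  - move=> a x y c d [G FG Gx] [G' FG' Gy].
    have [GG'|G'G] := Ftot _ _ FG FG'.
      by exists G' => //; have [lin _ _] := FP _ FG'; apply: lin => //; exact: GG'.
    by exists G => //; have [lin _ _] := FP _ FG; apply: lin => //; exact: G'G.
  - by move=> c [G FG Gc]; have [_ fun_ _] := FP _ FG; exact: fun_.
  - move=> [x [G FG Gx]] y G0y; exists G => //.
    by have [_ _ sub] := FP _ FG; apply: sub => //; exists x.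
have {}GG0 : G0 `<=` G.
  apply: GG0; apply: contrapT => /set0P/negP; rewrite negbK => /eqP Gempty.
  apply: (Gmax G0); last by split => // _ z.
  by rewrite Gempty; split => // h; exact: (h _ G00).
have total x : exists c, G (x, c).
  apply: contrapT => nx.
  (* The extension of [G] that takes the value 0 at the missing vector x. *)
  pose B := [set z | exists y c t, G (y, c) /\ z = (y + t *: x, c)].
  have GB : G `<=` B.
    by move=> [y c] Gy; exists y, c, 0; rewrite scale0r addr0.
  apply: (Gmax B).
    split => // BG; apply: nx; exists 0; apply: BG; exists 0, 0, 1.
    by rewrite add0r scale1r; split => //; exact: GG0.
  split.
  - move=> a y z c d [y1 [c1 [t1 [G1 [-> ->]]]]] [y2 [c2 [t2 [G2 [-> ->]]]]].
    exists (a *: y1 + y2), (a * c1 + c2), (a * t1 + t2); split; first exact: Glin.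
    by congr (_, _); rewrite scalerDr scalerDl scalerA addrACA.
  - move=> c [y [c' [t [Gy [/esym yt ->]]]]].
    have [t0|t0] := eqVneq t 0.
      by move: yt; rewrite t0 scale0r addr0 => y0; apply: Gfun; rewrite -y0.
    case: nx; exists (- t^-1 * c').
    have := Glin (- t^-1) _ _ _ _ Gy (GG0 _ G00); rewrite !addr0.
    have -> : - t^-1 *: y = x; last by [].
    move/eqP: yt; rewrite addr_eq0 => /eqP ->.
    by rewrite scalerN scaleNr opprK scalerA mulVf // scale1r.
  - by move=> _; exact: subset_trans GB.
have /choice[L GL] := total.
have Luniq x c : G (x, c) -> L x = c.
  move=> Gx; have := Glin (-1) _ _ _ _ (GL x) Gx.
  rewrite scaleN1r addNr => /Gfun; rewrite mulN1r => /eqP.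
  by rewrite addrC subr_eq0 => /eqP.
exists L; split => [a x y|x c /GG0]; last exact: Luniq.
by apply: Luniq; exact: Glin.
Qed.

(** The graph of the limit along a free ultrafilter is extended linearly to all sequences. Bounded
    sequences do converge along it, which gives the bound. *)
Lemma real_limit_functional (R : realType) : exists L : (nat -> R) -> R,
  [/\ forall a c d, L (a *: c + d) = a * L c + L d,
      forall c (M : R), (forall n, `|c n| <= M) -> `|L c| <= M &
      forall c a N, (forall n, (N <= n)%N -> c n = a) -> L c = a].
Proof.
have [U [UU sU]] := ultraFilterLemma (eventually_filter : ProperFilter \oo).
pose G0 : set ((nat -> R) * R) := [set z | z.1 @ U --> z.2].
have [|||L [Llin LG0]] := @linear_extension R (nat -> R) G0.
- exact: cvg_cst.
- by move=> a x y c d xc yd; apply: cvgD => //; exact: cvgZr.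
- move=> c /= c0; have c00 : (fun=> 0 : R) @ U --> (0 : R) by exact: cvg_cst.
  exact: (cvg_unique _ c0 c00).
exists L; split => // [c M cM|c a N cN]; last first.
  apply: LG0 => B aB; apply: sU; exists N => // n Nn; rewrite /= cN //.
  exact: nbhs_singleton.
have [|z /= zM cz] := @ultra_compact_cvg _ _ U c _ UU (@segment_compact R (- M) M).
  by apply: sU; exists 0%N => // n _ /=; rewrite in_itv /= -ler_norml.
by rewrite (LG0 _ _ cz) ler_norml; move: zM; rewrite in_itv.
Qed.

(** The real functional acts on real and imaginary parts separately, each bounded by M; hence the
    factor 2. *)
Lemma limit_functional (R : realType) : exists L : (nat -> R[i]) -> R[i],
  [/\ forall a c d, L (a *: c + d) = a * L c + L d,
      forall c (M : R), (forall n, normc (c n) <= M) -> normc (L c) <= 2 * M &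
      forall c a N, (forall n, (N <= n)%N -> c n = a) -> L c = a].
Proof.
have [L [Llin Lbnd Lcst]] := real_limit_functional R.
have LD c d : L (c + d) = L c + L d by have := Llin 1 c d; rewrite scale1r mul1r.
have L0 : L 0 = 0 by exact: (Lcst _ _ 0%N).
have LZ a c : L (a *: c) = a * L c by have := Llin a c 0; rewrite !addr0 L0 addr0.
exists (fun c => L (fun n => Re (c n)) +i* L (fun n => Im (c n))); split.
- move=> [a b] c d.
  have -> : (fun n => Re (((a +i* b) *: c + d) n)) =
      a *: (fun n => Re (c n)) + ((- b) *: (fun n => Im (c n)) + (fun n => Re (d n))).
    apply/funext => n; have -> : ((a +i* b) *: c + d) n = (a +i* b) * c n + d n by [].
    rewrite !fctE; case: (c n) => p q; case: (d n) => r t /=.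
    by rewrite /GRing.scale /=; ring.
  have -> : (fun n => Im (((a +i* b) *: c + d) n)) =
      a *: (fun n => Im (c n)) + (b *: (fun n => Re (c n)) + (fun n => Im (d n))).
    apply/funext => n; have -> : ((a +i* b) *: c + d) n = (a +i* b) * c n + d n by [].
    rewrite !fctE; case: (c n) => p q; case: (d n) => r t /=.
    by rewrite /GRing.scale /=; ring.
  by rewrite !LD !LZ; simpc; congr (_ +i* _); ring.
- move=> c M cM.
  have h1 : `|L (fun n => Re (c n))| <= M.
    by apply: Lbnd => n; exact: le_trans (normc_Re _) (cM n).
  have h2 : `|L (fun n => Im (c n))| <= M.
    by apply: Lbnd => n; exact: le_trans (normc_Im _) (cM n).
  apply: (le_trans (normc_le_ReIm _)) => /=; lra.
- move=> c [a b] N cN; congr (_ +i* _).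
    by apply: (Lcst _ _ N) => n /cN ->.
  by apply: (Lcst _ _ N) => n /cN ->.
Qed.

(** * Twisted sums along a quasilinear map *)

Section Subspace.
Variables (K : nzRingType) (V : lmodType K) (S : pred V).
Hypothesis S_closed : GRing.subsemimod_closed S.

(* The closure proof is an argument of the type so that the module structure
   can be inferred from the type alone. *)
Definition subspace of GRing.subsemimod_closed S := {x : V | S x}.

Local Notation W := (subspace S_closed).

HB.instance Definition _ := SubChoice.copy W {x : V | S x}.
HB.instance Definition _ :=
  GRing.SubChoice_isSubLmodule.Build K V S W S_closed.

End Subspace.

Lemma complex_complete (R : realType) (u : nat -> R[i]) :
  (forall e : R, 0 < e -> exists n0, forall m n, (n0 <= m)%N -> (n0 <= n)%N ->
     normc (u m - u n) < e) ->
  exists l, forall e : R, 0 < e -> exists n0, forall n, (n0 <= n)%N ->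
    normc (u n - l) < e.
Proof.
move=> cu.
have part (g : R[i] -> R) : (forall a, `|g a| <= normc a) ->
    (forall a b, g (a - b) = g a - g b) -> exists l, forall e : R, 0 < e ->
    exists n0, forall n, (n0 <= n)%N -> `|g (u n) - l| < e.
  move=> gle gB; have cvu : cvgn (g \o u).
    apply/cauchy_cvgP/cauchyP => e e0; have [n0 hn0] := cu _ e0.
    exists (g (u n0)); exists n0 => // n /= n0n.
    rewrite -ball_normE /ball_ /= -gB; apply: (le_lt_trans (gle _)).
    exact: hn0.
  exists (limn (g \o u)) => e e0.
  have /cvgrPdist_lt/(_ e e0)[n0 _ hn0] := cvu.
  by exists n0 => n n0n; rewrite distrC; exact: hn0.
have [a ha] := part _ (@normc_Re R) (fun a b => raddfB (@complex.Re R : Rcomplex R -> R) a b).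
have [b hb] := part _ (@normc_Im R) (fun a b => raddfB (@complex.Im R : Rcomplex R -> R) a b).
exists (a +i* b) => e e0; have e2 : 0 < e / 2 by rewrite divr_gt0.
have [n1 hn1] := ha _ e2; have [n2 hn2] := hb _ e2.
exists (maxn n1 n2) => n; rewrite geq_max => /andP[/hn1 h1 /hn2 h2].
apply: (le_lt_trans (normc_le_ReIm _)); rewrite [ltRHS](splitr e).
by move: h1 h2; case: (u n) => p q /= h1 h2; exact: ltrD.
Qed.

Section Quasilinear.
Variables (R : realType) (V : lmodType R[i]) (D : set V) (N : V -> R).
Hypothesis DN : is_quasi_banach D N.

Let D0 : D 0. Proof. exact: quasinormed0 DN.1. Qed.
Let Dlin a x y : D x -> D y -> D (a *: x + y).
Proof. exact: (quasinormedP DN.1). Qed.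
Let DB x y : D x -> D y -> D (x - y).
Proof. by move=> Dx Dy; rewrite addrC -scaleN1r; exact: Dlin. Qed.
Let DD x y : D x -> D y -> D (x + y).
Proof. by move=> Dx Dy; rewrite -[x]scale1r; exact: Dlin. Qed.
Let N_ge0 x : D x -> 0 <= N x. Proof. exact: (quasinorm_ge0 DN.1). Qed.
Let NZ a x : D x -> N (a *: x) = normc a * N x.
Proof. exact: (quasinormZ DN.1). Qed.
Let N0 : N 0 = 0.
Proof. by rewrite -(scale0r 0) NZ // Normc.normc0 mul0r. Qed.

Variable phi : V -> R[i].
Hypothesis phiZ : forall a x, D x -> phi (a *: x) = a * phi x.
Variable Q : R.
Hypothesis Q_ge0 : 0 <= Q.
Hypothesis phiD : forall x y, D x -> D y ->
  normc (phi (x + y) - phi x - phi y) <= Q * (N x + N y).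

Let S : pred V := fun x => `[< D x >].

Let S_closed : GRing.subsemimod_closed S.
Proof.
split; first split.
- exact/asboolP.
- by move=> x y /asboolP Dx /asboolP Dy; apply/asboolP; exact: DD.
- by move=> a x /asboolP Dx; apply/asboolP; rewrite -[_ *: _]addr0; exact: Dlin.
Qed.

Let W := subspace S_closed.
Let Z := (W * R[i]^o)%type.

Let DW (w : W) : D (val w). Proof. exact/asboolP/(valP w). Qed.

Let NT (z : Z) : R := N (val z.1) + normc (z.2 - phi (val z.1)).

Let phi0 : phi 0 = 0.
Proof. by rewrite -(scale0r 0) phiZ // mul0r. Qed.

Let twisted_quasinormed : is_quasinormed setT NT.
Proof.
split=> //.
- by move=> z _; exact: addr_ge0 (N_ge0 (DW _)) (normc_ge0 _).
- move=> [w c] _ /eqP; rewrite /NT /= (paddr_eq0 (N_ge0 (DW w)) (normc_ge0 _)).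
  move=> /andP[/eqP Nw /eqP/Normc.eq0_normc cw].
  have w0 : w = 0 by apply/val_inj; rewrite (quasinorm_eq0 DN.1 (DW w) Nw).
  by move: cw; rewrite w0 /= phi0 subr0 => ->.
- move=> a [w c] _; rewrite /NT /= (NZ _ (DW w)) (phiZ _ (DW w)) mulrDr -Normc.normcM.
  by congr (_ + normc _); rewrite mulrBr.
have [K hK] := quasinormD DN.1.
exists (`|K| + Q + 1) => -[w c] [v d] _ _; rewrite /NT /=.
set x := val w; set y := val v.
have Dx : D x := DW w; have Dy : D y := DW v.
have h1 : N (x + y) <= `|K| * (N x + N y).
  by apply: (le_trans (hK _ _ Dx Dy)); rewrite ler_wpM2r ?addr_ge0 ?N_ge0 // ler_norm.
have h2 : normc (c + d - phi (x + y)) <=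
    normc (c - phi x) + normc (d - phi y) + Q * (N x + N y).
  have -> : c + d - phi (x + y) = (c - phi x) + (d - phi y) - (phi (x + y) - phi x - phi y).
    by ring.
  apply: (le_trans (le_normcD _ _)); rewrite normcN; apply: lerD (phiD Dx Dy).
  exact: le_normcD.
have := N_ge0 Dx; have := N_ge0 Dy; have := normc_ge0 (c - phi x).
have := normc_ge0 (d - phi y); have := normr_ge0 K.
move: (normc (c - phi x)) (normc (d - phi y)) (N x) (N y) `|K| h1 h2.
move: (N (x + y)) (normc _) => A B p q a b k h1 h2 k0 q0 p0 b0 a0.
have : 0 <= (k + Q) * (p + q) by rewrite mulr_ge0 ?addr_ge0.
nra.
Qed.

(** Since phi need not be continuous, the second components are corrected before taking a limit:
    with x the limit of the first ones, [C n - phi (X n - x)] is Cauchy by quasilinearity, and its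
    limit l makes (x, l) the limit in [NT]. *)
Let twisted_complete : quasinorm_complete setT NT.
Proof.
move=> u _ cu.
pose X n := val (u n).1; pose C n : R[i] := (u n).2.
have DX n : D (X n) := DW _.
have NTE m n : NT (u m - u n) =
  N (X m - X n) + normc (C m - C n - phi (X m - X n)) by [].
have cX e : 0 < e -> exists n0, forall m n, (n0 <= m)%N -> (n0 <= n)%N ->
    N (X m - X n) < e.
  move=> /cu[n0 hn0]; exists n0 => m n n0m n0n.
  by apply: le_lt_trans (hn0 m n n0m n0n); rewrite NTE lerDl normc_ge0.
have [x Dx /cvgrPdist_lt hx] := DN.2 X DX cX.
have {}hx e : 0 < e -> exists n0, forall n, (n0 <= n)%N -> N (X n - x) < e.
  move=> /hx[n0 _ hn0]; exists n0 => n /hn0 /=.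
  by rewrite sub0r normrN ger0_norm // N_ge0 //; exact: DB.
pose d n := C n - phi (X n - x).
have [|l hl] := @complex_complete R d.
  move=> e e0; have Q1 : 0 < 1 + 2 * Q by rewrite ltr_pwDl // mulr_ge0.
  (* The correction costs Q times two norms below this tolerance, on top of one term below it. *)
  have e1 : 0 < e / (1 + 2 * Q) by rewrite divr_gt0.
  have [n1 hn1] := cu _ e1; have [n2 hn2] := hx _ e1.
  exists (maxn n1 n2) => m n; rewrite !geq_max => /andP[n1m n2m] /andP[n1n n2n].
  have := hn1 _ _ n1m n1n; rewrite NTE => h1; have h2 := hn2 _ n2n.
  have XX : X m - x = (X m - X n) + (X n - x) by rewrite addrA subrK.
  have h3 := phiD (DB (DX m) (DX n)) (DB (DX n) Dx); rewrite -XX in h3.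
  have h4 : normc (d m - d n) <= normc (C m - C n - phi (X m - X n)) +
      Q * (N (X m - X n) + N (X n - x)).
    have -> : d m - d n = (C m - C n - phi (X m - X n)) -
      (phi (X m - x) - phi (X m - X n) - phi (X n - x)) by rewrite /d; ring.
    by apply: (le_trans (le_normcD _ _)); rewrite normcN; apply: lerD.
  have p0 := N_ge0 (DB (DX m) (DX n)).
  have q0 := normc_ge0 (C m - C n - phi (X m - X n)).
  have eE : e / (1 + 2 * Q) + Q * (e / (1 + 2 * Q) + e / (1 + 2 * Q)) = e.
    by field; rewrite gt_eqF.
  apply: (le_lt_trans h4); rewrite -[ltRHS]eE; apply: ltr_leD.
    by apply: le_lt_trans h1; rewrite lerDr.
  apply: ler_wpM2l => //; apply: lerD; apply: ltW => //.
  by apply: le_lt_trans h1; rewrite lerDl.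
pose z : Z := (exist _ x (asboolT Dx) : W, l : R[i]^o).
exists z => //; apply/cvgrPdist_lt => e e0; have e2 : 0 < e / 2 by rewrite divr_gt0.
have [n1 hn1] := hx _ e2; have [n2 hn2] := hl _ e2.
exists (maxn n1 n2) => // n /=; rewrite geq_max => /andP[/hn1 h1 /hn2 h2].
have NTz : NT (u n - z) = N (X n - x) + normc (d n - l).
  by rewrite /NT /=; congr (_ + normc _); rewrite /d /C addrAC.
rewrite sub0r normrN NTz ger0_norm.
  by rewrite [ltRHS](splitr e); exact: ltrD.
by rewrite addr_ge0 ?normc_ge0 ?N_ge0 //; exact: DB.
Qed.

(** For a left inverse P of j put l(x) = - P(x, 0). Then phi(x) - l(x) = P(x, phi(x)), and the
    vector (x, phi(x)) has [NT] equal to N(x). Continuity of P at 0 provides M. *)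
Lemma K_space_quasilinear : K_space D N ->
  exists l : V -> R[i], exists M : R,
    (forall a x y, D x -> D y -> l (a *: x + y) = a * l x + l y) /\
    forall x, D x -> normc (phi x - l x) <= M * N x.
Proof.
move=> KD.
have jlin : linear (fun c : R[i]^o => (0, c) : Z).
  by move=> a c d; rewrite /GRing.scale /= /scale_pair /=; congr (_, _); rewrite scaler0 addr0.
have qlin : linear (fun z : Z => val z.1).
  by [].
pose jm := GRing.isLinear.Build _ _ _ *:%R _ jlin.
pose j : {linear R[i]^o -> Z} := HB.pack (fun c : R[i]^o => (0, c) : Z) jm.
pose qm := GRing.isLinear.Build _ _ _ *:%R _ qlin.
pose q : {linear Z -> V} := HB.pack (fun z : Z => val z.1) qm.
have NTj c : NT (j c) = normc c by rewrite /NT /= N0 add0r phi0 subr0.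
have [||||||P Pcont Pj] := KD Z NT j q.
- by split; [exact: twisted_quasinormed|exact: twisted_complete].
- by move=> x e e0; exists e => // y; rewrite -linearB NTj.
- move=> x e e0; exists e => // y; apply: le_lt_trans.
  by rewrite -linearB /NT lerDl normc_ge0.
- by move=> c d [].
- apply/seteqP; split => [_ [c _ <-]//|[w c] /= w0].
  exists c => //; congr (_, _); apply/val_inj; exact/esym/w0.
- apply/seteqP; split => [_ [[w c] _ <-]|x Dx]; first exact: DW.
  by exists (exist _ x (asboolT Dx) : W, 0).
have [dl dl0 hP] := Pcont 0 1 ltr01.
have {}hP y : NT y < dl -> normc (P y) < 1.
  have := hP y; have -> : P y - P 0 = P y by rewrite linear0; exact: subr0.
  by rewrite subr0.
have Pbound z : normc (P z) <= 2 / dl * NT z.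
  have zge : 0 <= NT z := addr_ge0 (N_ge0 (DW _)) (normc_ge0 _).
  have [z0|z0] := eqVneq (NT z) 0.
    have -> : z = 0 by exact: (quasinorm_eq0 twisted_quasinormed).
    rewrite linear0 Normc.normc0 mulr_ge0 ?divr_ge0 ?(ltW dl0) //.
    exact: addr_ge0 (N_ge0 (DW _)) (normc_ge0 _).
  have zp : 0 < NT z by rewrite lt_neqAle eq_sym z0.
  have tp : 0 < dl / (2 * NT z) by rewrite divr_gt0 ?mulr_gt0.
  have := hP ((dl / (2 * NT z))%:C *: z).
  rewrite linearZ (quasinormZ twisted_quasinormed) // Normc.normcM.
  rewrite normc_real gtr0_norm // => h; have {h} : dl / (2 * NT z) * normc (P z) < 1.
    apply: h; have -> : dl / (2 * NT z) * NT z = dl / 2 by field.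
    by rewrite ltr_pdivrMr // ltr_pMr // ltr1n.
  rewrite -ltr_pdivlMl // mulr1 => /ltW h; apply: (le_trans h).
  by rewrite le_eqVlt; apply/orP; left; apply/eqP; field; rewrite ?z0 ?gt_eqF.
pose emb x : W := if pselect (D x) is left Dx then exist _ x (asboolT Dx) else 0.
have embE x : D x -> val (emb x) = x.
  by rewrite /emb; case: pselect.
exists (fun x => - P (emb x, 0)), (2 / dl); split => [a x y Dx Dy|x Dx].
  have -> : (emb (a *: x + y), 0) = a *: ((emb x, 0) : Z) + (emb y, 0).
    apply: injective_projections; last by rewrite /= scaler0 addr0.
    by apply/val_inj; rewrite /= embE ?linearP ?embE //; exact: Dlin.
  by rewrite linearP opprD mulrN.
have -> : phi x - - P (emb x, 0) = P (emb x, phi x : R[i]^o).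
  rewrite opprK -[phi x in LHS]Pj -linearD; congr (P _); congr (_, _).
    by rewrite add0r.
  by rewrite addr0.
apply: (le_trans (Pbound _)).
by rewrite /NT /= embE // subrr Normc.normc0 addr0.
Qed.

End Quasilinear.

(** * Ribe's map on finite sequences *)

Section Ribe.
Variable R : realType.
Implicit Types (z w c : R[i]).

(** For t > 0 the quantity is t ln(m / t), and ln y < y at y = m / t. *)
Lemma entropy_bound (t m : R) : 0 <= t -> t <= m -> `|t * (ln m - ln t)| <= m.
Proof.
move=> t0 tm; have m0 := le_trans t0 tm.
have [->|tn] := eqVneq t 0; first by rewrite mul0r normr0.
have tp : 0 < t by rewrite lt_neqAle eq_sym tn.
have mp : 0 < m := lt_le_trans tp tm.
rewrite -ln_div ?posrE // normrM (gtr0_norm tp) ger0_norm; last first.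
  by rewrite ln_ge0 // ler_pdivlMr // mul1r.
rewrite mulrC -ler_pdivlMr //; apply/ltW/ln_sublinear.
by rewrite divr_gt0.
Qed.

Definition zlogz z : R[i] := z * (ln (normc z))%:C.

Lemma zlogz_bound z (m : R) : normc z <= m ->
  normc (z * (ln m)%:C - zlogz z) <= m.
Proof.
move=> zm; rewrite /zlogz -mulrBr -rmorphB Normc.normcM normc_real.
rewrite -{1}(ger0_norm (normc_ge0 z)) -normrM.
exact: entropy_bound (normc_ge0 z) zm.
Qed.

(** Replacing all three logarithms by ln m, with m = |z| + |w|, leaves a linear expression, which
    cancels; each replacement costs at most m. *)
Lemma zlogzD z w :
  normc (zlogz (z + w) - zlogz z - zlogz w) <= 3 * (normc z + normc w).
Proof.
set m := normc z + normc w.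
have -> : zlogz (z + w) - zlogz z - zlogz w =
    (z * (ln m)%:C - zlogz z) + (w * (ln m)%:C - zlogz w) -
    ((z + w) * (ln m)%:C - zlogz (z + w)) by ring.
apply: (le_trans (le_normcD _ _)); rewrite normcN.
have h1 : normc (z * (ln m)%:C - zlogz z) <= m.
  by apply: zlogz_bound; rewrite /m lerDl; exact: normc_ge0.
have h2 : normc (w * (ln m)%:C - zlogz w) <= m.
  by apply: zlogz_bound; rewrite /m lerDr; exact: normc_ge0.
have h3 : normc ((z + w) * (ln m)%:C - zlogz (z + w)) <= m.
  by apply: zlogz_bound; exact: le_normcD.
have := le_normcD (z * (ln m)%:C - zlogz z) (w * (ln m)%:C - zlogz w).
lra.
Qed.

Lemma zlogzM c z : zlogz (c * z) = c * zlogz z + c * (ln (normc c))%:C * z.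
Proof.
have [->|c0] := eqVneq c 0; first by rewrite /zlogz !mul0r addr0.
have [->|z0] := eqVneq z 0; first by rewrite /zlogz !(mulr0, mul0r) addr0.
by rewrite /zlogz Normc.normcM lnM ?posrE ?normc_gt0 // rmorphD; ring.
Qed.

Definition ribe n (a : nat -> R[i]) : R[i] :=
  \sum_(k < n) zlogz (a k) - zlogz (\sum_(k < n) a k).

(** The failure of [zlogz] to be homogeneous is linear in z, so it is the same for the sum of the
    values as for the value at the sum; the subtraction in [ribe] removes it. *)
Lemma ribeZ n c a : ribe n (fun k => c * a k) = c * ribe n a.
Proof.
rewrite /ribe -mulr_sumr zlogzM; under eq_bigr do rewrite zlogzM.
by rewrite big_split /= -!mulr_sumr; ring.
Qed.

Lemma normc_sum n (a : nat -> R[i]) :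
  normc (\sum_(k < n) a k) <= \sum_(k < n) normc (a k).
Proof.
elim: n => [|n IHn]; first by rewrite !big_ord0 Normc.normc0.
by rewrite !big_ord_recr /= (le_trans (le_normcD _ _)) // lerD2r.
Qed.

(** 3 for the termwise defects of [zlogz], and 3 for its defect at the two sums. *)
Lemma ribeD n a b : normc (ribe n (fun k => a k + b k) - ribe n a - ribe n b) <=
  6 * (\sum_(k < n) normc (a k) + \sum_(k < n) normc (b k)).
Proof.
pose dd z w := zlogz (z + w) - zlogz z - zlogz w.
have -> : ribe n (fun k => a k + b k) - ribe n a - ribe n b =
    \sum_(k < n) dd (a k) (b k) - dd (\sum_(k < n) a k) (\sum_(k < n) b k).
  by rewrite /ribe /dd !big_split /= !sumrN; ring.
apply: (le_trans (le_normcD _ _)); rewrite normcN.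
have h1 : normc (\sum_(k < n) dd (a k) (b k)) <=
    3 * (\sum_(k < n) normc (a k) + \sum_(k < n) normc (b k)).
  apply: (le_trans (normc_sum _ (fun k => dd (a k) (b k)))).
  by rewrite -big_split mulr_sumr; apply: ler_sum => k _; exact: zlogzD.
have h2 := zlogzD (\sum_(k < n) a k) (\sum_(k < n) b k).
have ha := normc_sum n a; have hb := normc_sum n b.
rewrite /dd in h1 *; lra.
Qed.

End Ribe.

(** * The quasilinear map on the Schatten class *)

Section Counterexample.
Variables (R : realType) (H : completeNormedModType R[i]).
Variable dot : {dot H for (@Num.conj R[i])}.
Hypothesis hdot : forall x : H, `|x| ^+ 2 = dot x x.
Implicit Types (u v w : H) (f g : H -> H).

Lemma orthonormal_exists : infinite_dimensional H ->
  exists2 e : nat -> H, orthosystem dot e & forall n, nr (e n) = 1.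
Proof.
move=> Hinf.
pose ext (l : seq H) := xget 0 [set y | nr y = 1 /\ forall z, z \in l -> dot y z = 0].
pose pre := fix pre n := if n is m.+1 then rcons (pre m) (ext (pre m)) else [::].
pose e n := ext (pre n).
have pre_e n z : z \in pre n -> exists2 k, (k < n)%N & z = e k.
  elim: n => [//|n IHn] /=; rewrite mem_rcons inE => /predU1P[->|/IHn[k kn ->]].
    by exists n.
  by exists k; rewrite // ltnW.
have e_pre n k : (k < n)%N -> e k \in pre n.
  elim: n => [//|n IHn]; rewrite ltnS leq_eqVlt /= mem_rcons inE.
  by case/predU1P => [->|/IHn ->]; rewrite ?eqxx ?orbT.
have eP n : nr (e n) = 1 /\ forall k, (k < n)%N -> dot (e n) (e k) = 0.
  elim/ltn_ind: n => n IHn.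
  suff [y [y1 yo]] : exists y, nr y = 1 /\ forall k, (k < n)%N -> dot y (e k) = 0.
    have [|h1 h2] := @xgetPex _ 0 [set y | nr y = 1 /\ forall z, z \in pre n -> dot y z = 0].
      by exists y; split => // z /pre_e[k kn ->]; exact: yo.
    by split => // k kn; apply: h2; exact: e_pre.
  (* Cut off by zeros, the part already known to be orthonormal is an [orthosystem]. If every v
     equals its projection, these n vectors form a basis of [H], which is excluded. *)
  pose x k := if (k < n)%N then e k else 0.
  have ox : orthosystem dot x.
    split=> [i j ij|i]; rewrite /x; last first.
      by case: ifP => [/IHn[]|]; [left|right].
    case: ifP => [iin|_]; last by rewrite dot0l.
    case: ifP => [jn|_]; last by rewrite dot0r.
    move: ij; rewrite neq_ltn => /orP[ij|ij]; last by have [_] := IHn _ iin; apply.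
    by apply/dot_eq0_sym; have [_] := IHn _ jn; apply.
  have xE k : (k < n)%N -> x k = e k by rewrite /x => ->.
  have [[v v0]|allproj] := pselect (exists v, v - orthoproj dot x n v != 0).
    set w := v - orthoproj dot x n v in v0; have wp := nr_gt0 v0.
    exists ((nr w)^-1%:C *: w); split.
      by rewrite nrZ normc_real gtr0_norm ?invr_gt0 // mulVf ?gt_eqF.
    by move=> k kn; rewrite dotZl -xE // (orthoproj_resid hdot _ ox) ?mulr0.
  case: (Hinf n); exists (fun i : 'I_n => x i).
    move=> a aE j; have : dot (\sum_i a i *: x i) (x j) = 0 by rewrite aE dot0l.
    rewrite dot_suml (bigD1 j) //= big1 ?addr0.
      rewrite dotZl (dotxx hdot) xE //; have [-> _] := IHn _ (ltn_ord j).
      by rewrite expr1n mulr1.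
    by move=> i ij; rewrite dotZl ox.1 ?mulr0.
  apply/seteqP; split=> // v _; exists (fun i => dot v (x i)) => //.
  apply/esym/eqP; rewrite -subr_eq0; apply: contraT => v0.
  by case: allproj; exists v.
exists e => [|n]; last by have [] := eP n.
split=> [m n|n]; last by left; have [] := eP n.
rewrite neq_ltn => /orP[mn|nm]; last by have [_] := eP m; apply.
by apply/dot_eq0_sym; have [_] := eP n; apply.
Qed.

Variable p : R.
Hypotheses (p_gt0 : 0 < p) (p_lt1 : p < 1).

Local Notation S := (schatten dot p).
Local Notation N := (schatten_norm dot p).

Definition rank_one u : H -> H := fun v => dot v u *: u.

(** The operator vanishes on the complement of u, so s_1 = 0 and only s_0 <= |u|^2 contributes. *)
Lemma schatten_rank_one u : S (rank_one u) /\ N (rank_one u) <= nr u ^+ 2.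
Proof.
have cu : compact_operator (rank_one u) by exact: rank_one_compact.
apply: (schatten_bounded p_gt0) => // [|n]; first exact: sqr_ge0.
case: n => [|n]; first by rewrite big_ord0 powR_ge0.
rewrite big_ord_recl big1 ?addr0 => [|k _]; last first.
  suff -> : singular_numbers dot (rank_one u) (lift ord0 k) = 0.
    by rewrite powR0 // gt_eqF.
  apply/eqP; rewrite eq_le (sn_ge0 hdot) // andbT.
  apply: (le_trans (sn_noninc hdot (m := 1) cu _)) => //.
  apply: (sn_le hdot (v := [:: u])) => // v vu; rewrite mul0r /rank_one vu.
    by rewrite scale0r nr0.
  by rewrite inE.
apply: ler_powRl; [exact: ltW|exact: sn_ge0|].
apply: (sn_le hdot (v := [::])) => // [|v _]; first exact: sqr_ge0.
rewrite /rank_one nrZ (le_trans (ler_wpM2r (nr_ge0 u) (CauchySchwarz hdot v u))) //.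
by rewrite -mulrA mulrC expr2.
Qed.

Variable e : nat -> H.
Hypotheses (oe : orthosystem dot e) (e1 : forall n, nr (e n) = 1).

Definition diag f k : R[i] := dot (f (e k)) (e k).

(** Meant for u = x_m and v = f x_m: one Schmidt term adds at most s_m to the l^1 norm of the
    diagonal. The weight s balances the two Bessel sums. *)
Lemma diag_pair_sum (s : R) u v n : 0 < s -> nr u = 1 -> nr v = s ->
  \sum_(k < n) normc (dot (e k) u) * normc (dot v (e k)) <= s.
Proof.
move=> s0 u1 vs.
have sE : s = s / 2 * nr u ^+ 2 + (2 * s)^-1 * nr v ^+ 2.
  by rewrite u1 vs; field; rewrite gt_eqF.
rewrite [leRHS]sE.
apply: (@le_trans _ _ (s / 2 * (\sum_(k < n) normc (dot u (e k)) ^+ 2) +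
    (2 * s)^-1 * (\sum_(k < n) normc (dot v (e k)) ^+ 2))); last first.
  apply: lerD; apply: ler_wpM2l; try exact: (bessel hdot).
    by rewrite divr_ge0 // ltW.
  by rewrite invr_ge0 mulr_ge0 // ltW.
rewrite !mulr_sumr -big_split /=; apply: ler_sum => k _.
rewrite (dotC dot u) normc_conj.
move: (normc (dot u (e k))) (normc (dot v (e k))) => a b.
(* arithmetic-geometric mean: a b <= (s a^2 + b^2 / s) / 2 *)
rewrite -subr_ge0.
have -> : s / 2 * a ^+ 2 + (2 * s)^-1 * b ^+ 2 - a * b = (2 * s)^-1 * (s * a - b) ^+ 2.
  by field; rewrite gt_eqF.
by rewrite mulr_ge0 ?sqr_ge0 // invr_ge0 mulr_ge0 // ltW.
Qed.

(** Cut the Schmidt expansion where s_M < eps: each of the n entries changes by at most eps, and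
    exchanging the sums leaves the sum of the s_m, bounded by |f|_p as p < 1. *)
Lemma diag_summable f n : S f -> \sum_(k < n) normc (diag f k) <= N f.
Proof.
move=> Sf; have cf := Sf.1; have [x hx] := schmidtP hdot cf.
set s := singular_numbers dot f in hx.
have [f' fE] := linear_bundle (schmidt_linear hx).
have fproj M u : f (u - orthoproj dot x M u) =
    f u - \sum_(m < M) dot u (x m) *: f (x m).
  rewrite fE linearB linear_sum; congr (_ - _).
  by apply: eq_bigr => m _; rewrite linearZ.
rewrite -subr_le0; apply: (@le_eps_mul _ _ n%:R) => // eps eps0.
have [M sM] := schmidt_small hx eps0.
rewrite lerBlDr addrC.
apply: (@le_trans _ _ (\sum_(k < n)
    (\sum_(m < M) normc (dot (e k) (x m)) * normc (dot (f (x m)) (e k)) + eps))).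
  apply: ler_sum => k _.
  have -> : diag f k = \sum_(m < M) dot (e k) (x m) * dot (f (x m)) (e k) +
      dot (f (e k - orthoproj dot x M (e k))) (e k).
    rewrite fproj dotBl dot_suml /diag addrC -addrA -[LHS]addr0; congr (_ + _).
    by rewrite addrC (eq_bigr _ (fun m _ => dotZl dot _ _ _)) subrr.
  apply: (le_trans (le_normcD _ _)); apply: lerD.
    apply: (le_trans (normc_sum _ (fun m => dot (e k) (x m) * dot (f (x m)) (e k)))).
    by apply: ler_sum => m _; rewrite Normc.normcM.
  apply: (le_trans (CauchySchwarz hdot _ _)); rewrite e1 mulr1.
  apply: (le_trans (schmidt_tail hx (n := M) _)).
    by move=> m mM; exact: (orthoproj_resid hdot _ (schmidt_ortho hx)).
  have := orthoproj_le hdot hx M (e k); rewrite e1 => h.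
  apply: (le_trans (ler_wpM2l (schmidt_ge0 hx M) h)).
  by rewrite mulr1 ltW.
rewrite big_split /= sumr_const card_ord mulr_natr lerD2r exchange_big /=.
apply: (le_trans _ (sn_sum_le hdot p_gt0 p_lt1 M Sf)); apply: ler_sum => m _.
have [s0|s0] := eqVneq (s m) 0.
  rewrite big1 ?(schmidt_ge0 hx) // => k _.
  by rewrite (schmidt_null hx s0) dot0r Normc.normc0 mul0r.
apply: diag_pair_sum; last exact: (schmidt_norm hx).
  by rewrite lt_neqAle eq_sym s0 (schmidt_ge0 hx).
exact: (schmidt_unit hx).
Qed.

Lemma ribe_indicator n (a : nat -> R[i]) (b : nat -> bool) :
  (forall k, a k = (b k)%:R) ->
  ribe n a = - zlogz (\sum_(k < n) b k)%N%:R.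
Proof.
move=> ab; rewrite /ribe big1 ?sub0r => [|k _].
  by rewrite natr_sum; congr (- zlogz _); apply: eq_bigr.
by rewrite ab; case: (b k); rewrite /zlogz ?mul0r // Normc.normc1 ln1 mulr0.
Qed.

Lemma schatten_not_K_space : ~ K_space S N.
Proof.
have [L [Llin Lbnd Lcst]] := limit_functional R.
pose phi f := L (fun n => ribe n (diag f)).
have LZ a c : L (fun n => a * c n) = a * L c.
  have L0 : L 0 = 0 by exact: (Lcst _ _ 0%N).
  by have := Llin a c 0; rewrite !addr0 L0 addr0.
have LB c d : L (fun n => c n - d n) = L c - L d.
  have -> : (fun n => c n - d n) = -1 *: d + c.
    by apply/funext => n; rewrite !fctE scaleN1r addrC.
  by rewrite Llin mulN1r addrC.
have phiZ a f : S f -> phi (a *: f) = a * phi f.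
  move=> _; rewrite /phi -LZ; congr L; apply/funext => n; rewrite -ribeZ.
  by congr (ribe n); apply/funext => k; rewrite /diag -dotZl.
have phiD f g : S f -> S g ->
    normc (phi (f + g) - phi f - phi g) <= 12 * (N f + N g).
  move=> Sf Sg; rewrite /phi -!LB.
  (* 2 is the bound of [L] on bounded sequences, 6 the constant of [ribeD]. *)
  have twelve (t : R) : 12 * t = 2 * (6 * t) by ring.
  rewrite twelve.
  apply: Lbnd => n; have := ribeD n (diag f) (diag g).
  have -> : (fun k => diag f k + diag g k) = diag (f + g).
    by apply/funext => k; rewrite /diag -dotDl.
  move=> h; apply: (le_trans h); rewrite ler_pM2l //.
  by apply: lerD; exact: diag_summable.
move=> KS.
have [l [M [llin lM]]] := K_space_quasilinear
  (conj (schatten_quasinormed hdot p_gt0 p_lt1) (@schatten_complete _ _ _ hdot _ p_gt0 p_lt1))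
  phiZ (ler0n _ _ : 0 <= 12) phiD KS.
pose q u := l (rank_one u).
have Sr u : S (rank_one u) := (schatten_rank_one u).1.
have l0 : l 0 = 0.
  have := llin (-1) 0 0 (schatten0 hdot p_gt0) (schatten0 hdot p_gt0).
  by rewrite scaler0 addr0 mulN1r addNr.
have lD f g : S f -> S g -> l (f + g) = l f + l g.
  by move=> Sf Sg; have := llin 1 f g Sf Sg; rewrite scale1r mul1r.
have q_parallelogram u v : q (u + v) + q (u - v) = 2 * q u + 2 * q v.
  rewrite /q -lD //.
  have -> : rank_one (u + v) + rank_one (u - v) =
      (rank_one u + rank_one u) + (rank_one v + rank_one v).
    apply/funext => w; rewrite !fctE /rank_one dotDr dotBr.
    move: (dot w u) (dot w v) => a b.
    have -> : (a + b) *: (u + v) = (a *: u + b *: v) + (a *: v + b *: u).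
      by rewrite scalerDl !scalerDr [b *: u + _]addrC addrACA.
    have -> : (a - b) *: (u - v) = (a *: u + b *: v) - (a *: v + b *: u).
      by rewrite scalerBl !scalerBr opprB addrACA -opprD.
    by rewrite [LHS]addrACA subrr addr0 [LHS]addrACA.
  have SD f g : S f -> S g -> S (f + g).
    by move=> Sf Sg; have [] := schattenD hdot p_gt0 p_lt1 Sf Sg.
  by rewrite !lD //; [ring|exact: SD|exact: SD].
have qM u : normc (phi (rank_one u) - q u) <= `|M| * nr u ^+ 2.
  apply: (le_trans (lM _ (Sr u))); have [_ h] := schatten_rank_one u.
  apply: (le_trans (ler_wpM2r (schatten_norm_ge0 dot p _) (ler_norm M))).
  exact: ler_wpM2l.
have diagE u k : diag (rank_one u) k = (normc (dot u (e k)) ^+ 2)%:C.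
  by rewrite /diag /rank_one dotZl (dotC dot u) mulcJ.
(* From length n on, the Ribe values of this diagonal of zeros and ones are constant, and [L]
   returns that constant. *)
have phi_indicator u (b : nat -> bool) n : (forall k, (n <= k)%N -> b k = false) ->
    (forall k, normc (dot u (e k)) = (b k)%:R) ->
    phi (rank_one u) = - zlogz (\sum_(k < n) b k)%N%:R.
  move=> bn ub; apply: (Lcst _ _ n) => m nm.
  rewrite (@ribe_indicator _ _ b); last first.
    by move=> k; rewrite diagE ub; case: (b k); rewrite ?expr1n ?expr0n.
  congr (- zlogz _%:R).
  rewrite -(subnKC nm) big_split_ord /= [X in (_ + X)%N]big1 ?addn0 // => k _.
  by rewrite bn // leq_addr.
have phi_e k : phi (rank_one (e k)) = 0.
  rewrite (@phi_indicator _ (pred1 k) k.+1).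
  - rewrite (bigD1 ord_max) //= eqxx big1 => [|i ik].
      by rewrite addn0 /zlogz Normc.normc1 ln1 mulr0 oppr0.
    by rewrite (negPf ik : (i == k :> nat) = false).
  - by move=> j kj /=; rewrite gtn_eqF.
  - move=> j /=; have [->|jk] := eqVneq j k.
      by rewrite (dotxx hdot) e1 expr1n normc_real normr1.
    by rewrite oe.1 ?Normc.normc0 // eq_sym.
have q_e k : - `|M| <= Re (q (e k)).
  have := qM (e k); rewrite phi_e sub0r normcN e1 expr1n mulr1.
  by have := normc_Re (q (e k)); rewrite ler_norml => /andP[+ _]; lra.
(* One of the two signs in u +- e_n does not decrease the real part of q. *)
have signs n : exists u, [/\ nr u ^+ 2 = n%:R,
    forall k, normc (dot u (e k)) = (k < n)%:R & - `|M| * n%:R <= Re (q u)].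
  elim: n => [|n [u [un ue uq]]].
    exists 0; split=> [|k|]; first by rewrite nr0 expr0n.
      by rewrite dot0l Normc.normc0 ltn0.
    rewrite mulr0; suff -> : q 0 = 0 by [].
    by rewrite /q (_ : rank_one 0 = 0) //; apply/funext => v; rewrite /rank_one scaler0.
  have une : dot u (e n) = 0.
    by apply: Normc.eq0_normc; rewrite ue ltnn.
  have qpar := q_parallelogram u (e n).
  have {}qpar : Re (q (u + e n)) + Re (q (u - e n)) = 2 * Re (q u) + 2 * Re (q (e n)).
    by rewrite -ReD qpar ReD -!(rmorph_nat (real_complex R)) !ReM_real.
  have [c [c1 cq]] : exists c : R, `|c| = 1 /\ - `|M| * n.+1%:R <= Re (q (u + c%:C *: e n)).
    have := q_e n; have n1 : n.+1%:R = n%:R + 1 :> R by rewrite natr1.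
    have [h|h] := leP (- `|M| * n.+1%:R) (Re (q (u + e n))).
      by exists 1; rewrite normr1 scale1r.
    exists (-1); rewrite normrN1 rmorphN1 scaleN1r; split => //.
    rewrite n1 in h *; nra.
  exists (u + c%:C *: e n); split => //.
    rewrite (pythagoras hdot) ?dotZr ?une ?mulr0 //.
    by rewrite un nrZ normc_real c1 e1 mulr1 expr1n natr1.
  move=> k; rewrite dotDl dotZl ltnS.
  case: (ltngtP k n) => kn.
  - by rewrite oe.1 ?mulr0 ?addr0 ?ue ?kn // gtn_eqF.
  - by rewrite oe.1 ?mulr0 ?addr0 ?ue ?ltn_eqF // ltnNge ltnW.
  - by rewrite kn une add0r (dotxx hdot) e1 expr1n mulr1 normc_real c1.
(* So that ln n > 2 |M|: one |M| n is lost in [qM], the other in the lower bound for [q u]. *)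
pose n := (Num.trunc (expR (2 * `|M|))).+1.
have [u [un ue uq]] := signs n.
have n0 : 0 < n%:R :> R by rewrite ltr0n.
have := qM u; rewrite (phi_indicator _ (fun k => (k < n)%N) n) //; last first.
  by move=> k nk; rewrite ltnNge nk.
have -> : (\sum_(k < n) (k < n))%N = n.
  by rewrite (eq_bigr (fun=> 1%N)) ?sum1_card ?card_ord // => k _; rewrite ltn_ord.
rewrite un => h; have := normc_Re (- zlogz n%:R - q u).
have -> : Re (- zlogz n%:R - q u) = - (n%:R * ln n%:R) - Re (q u).
  rewrite /zlogz -(rmorph_nat (real_complex R)) normc_real gtr0_norm //.
  by case: (q u) => a b /=; rewrite mul0r subr0.
rewrite ler_norml => /andP[h1 _].
have h2 : n%:R * ln n%:R <= n%:R * (2 * `|M| : R).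
  by move: h h1 uq; rewrite mulrC; lra.
move: h2; rewrite ler_pM2l // leNgt => /negP; apply.
rewrite -ltr_expR lnK ?posrE //; exact: truncnS_gt.
Qed.

End Counterexample.

Theorem theorem3 (R : realType) (H : completeNormedModType R[i])
    (dot : {dot H for (@Num.conj R[i])})
    (hdot : forall x : H, `|x| ^+ 2 = dot x x)
    (hsep : separable H)
    (hinf : infinite_dimensional H)
    (p : R) (p_gt0 : 0 < p) (p_lt1 : p < 1) :
  is_quasi_banach (schatten dot p) (schatten_norm dot p) /\
  ~ K_space (schatten dot p) (schatten_norm dot p).
Proof.
split.
  split; first exact: schatten_quasinormed.
  exact: (@schatten_complete _ _ _ hdot _ p_gt0 p_lt1).
have [e oe e1] := orthonormal_exists hdot hinf.
exact (schatten_not_K_space hdot p_gt0 p_lt1 oe e1).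
Qed.
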